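(* Let $n\ge 2$ be an integer, let $\alpha>\tfrac12$, and put $\lambda=2\alpha$ (so $\lambda>1$). The following three assertions are equivalent. (1) For every increasing function $S:[0,+\infty)\to[0,+\infty)$ that is convex with respect to $\log$ and satisfies $$\int_0^1 S(tx)(1-x^2)^{n-2}x\,dx\le t^{\lambda}\quad\text{for all } t\in[0,+\infty),$$ one has $$\int_0^{+\infty}S(t)\frac{t^{2\lambda-1}}{(1+t^{2\lambda})^2}\,dt\le\frac{\pi(n-1)}{2\lambda}\prod_{k=1}^{n-1}\Bigl(1+\frac{\lambda}{2k}\Bigr).$$ (2) For every increasing function $h:[0,+\infty)\to[0,+\infty]$ satisfying $$\int_0^1\frac{h(tx)}{x}(1-x)^{n-1}\,dx\le t^{\alpha}\quad\text{for all } t\in[0,+\infty),$$ one has $$\int_0^{+\infty}\frac{h(t)}{t}\,\frac{dt}{1+t^{2\alpha}}\le\frac{\pi}{2}\prod_{k=1}^{n-1}\Bigl(1+\frac{\alpha}{k}\Bigr)=\frac{\pi}{2\alpha}\cdot\frac{1}{\mathrm{B}(\alpha,n)}.$$ (3) For every continuous function $q:[0,+\infty)\to[0,+\infty)$ satisfying $$\int_0^1\Bigl(\int_x^1(1-y)^{n-1}\frac{dy}{y}\Bigr)q(tx)\,dx\le t^{\alpha-1}\quad\text{for all } t\in[0,+\infty),$$ one has $$\int_0^{+\infty}q(t)\log\Bigl(1+\frac{1}{t^{2\alpha}}\Bigr)dt\le\pi\alpha\prod_{k=1}^{n-1}\Bigl(1+\frac{\alpha}{k}\Bigr)=\frac{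\pi}{\mathrm{B}(\alpha,n)}.$$
   Context: ''Increasing'' is meant in the non-strict sense: $x_1\le x_2$ implies $\phi(x_1)\le\phi(x_2)$. A function $\phi:[a,b)\to\mathbb{R}$ with $[a,b)\subset[0,+\infty]$ is called convex with respect to $\log$ if the function $x\mapsto\phi(e^x)$ is convex on $[\log a,\log b)\subset[-\infty,+\infty]$ (for $a=0$, $\log 0=-\infty$ and $e^{-\infty}=0$). $\mathrm{B}$ is Euler's beta function and $\log$ is the natural logarithm. In (3), for $t=0$ the value $0^{\alpha-1}$ is read as $+\infty$ if $\alpha<1$, as $1$ if $\alpha=1$, and as $0$ if $\alpha>1$. *)

(* Defs.v *)
From HB Require Import structures.
From mathcomp Require Export all_boot all_order all_algebra.
From mathcomp Require Export all_classical all_reals all_analysis.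
Export Order.TTheory GRing.Theory Num.Theory.
Export numFieldNormedType.Exports.

Set Implicit Arguments.
Unset Strict Implicit.
Unset Printing Implicit Defensive.

Local Open Scope classical_set_scope.
Local Open Scope ring_scope.

(* Throughout, a function on [0, +oo[ is a total function on R of which only
   the restriction to [0, +oo[ is constrained or used. *)

(* [phi : [a, b[ -> R] is convex with respect to log: the function
   [x |-> phi (e^x)] is convex on [log a, log b[, a subset of [-oo, +oo]. The
   points x and y are extended reals so that x = -oo is allowed when a = 0
   ([lne 0 = -oo] and [expeR -oo = 0]). They are below +oo, so the sum below
   is never of the form +oo - oo, and [0 * -oo = 0] in [\bar R] gives the
   expected value when t = 0 or t = 1. *)
Definition convex_wrt_log (R : realType) (a b : \bar R) (phi : R -> R) : Prop :=
  forall (x y : \bar R) (t : R),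
    (lne a <= x < lne b)%E -> (lne a <= y < lne b)%E -> 0 <= t <= 1 ->
    phi (fine (expeR (t%:E * x + (1 - t)%:E * y)%E)) <=
      t * phi (fine (expeR x)) + (1 - t) * phi (fine (expeR y)).

(* The library's [beta_fun] only takes natural number arguments. *)
Definition Beta (R : realType) (a b : R) : R :=
  \int[lebesgue_measure]_(x in `]0, 1[) (x `^ (a - 1) * (1 - x) `^ (b - 1)).

(* [t `^ r] for 0 <= t, except that 0 to a negative power is +oo; the library
   has [0 `^ r = 0] for every r <> 0. *)
Definition powRy (R : realType) (t r : R) : \bar R :=
  if (t == 0) && (r < 0) then +oo%E else (t `^ r)%:E.

(* Main.v *)
Require Import Defs.
From mathcomp Require Import all_boot all_order all_algebra.
From mathcomp Require Import all_classical all_reals all_analysis.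
From mathcomp Require Import measurable_realfun ring lra.
Import Order.TTheory GRing.Theory Num.Theory.
Import numFieldNormedType.Exports.

(** If [h t = \int_0^t q] and [S s = 2(n-1) \int_0^(s^2) h(v) dv/v], Tonelli's
    theorem turns each hypothesis and each conclusion of the three assertions
    into the next one. An increasing [h] always yields an increasing [S] that is
    convex with respect to log, and a continuous nonnegative [q] always yields an
    increasing [h], so the first assertion implies the second and the second
    implies the third. Conversely a given [S] need not come from a continuous
    [q]. Let [A f (t) = \int_0^t (f v - f (r v)) dv/v / (- ln r)] with [0 < r < 1];
    it is the average of [f] over [[r t, t]] for [dv/v], hence lies between
    [f (r t)] and [f t] when [f] is increasing. Truncate [S] near 0, and let [h]
    and then [q] be difference quotients in the variable [ln t]: the functions
    rebuilt from [q] lie below those they approximate, so that the hypothesis is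
    inherited, and above their dilates by powers of [r], so that the bound on the
    integral passes to [S (r t)], and to [S] as [r] tends to 1. *)

Set Implicit Arguments.
Unset Strict Implicit.
Unset Printing Implicit Defensive.
Local Open Scope classical_set_scope.
Local Open Scope ring_scope.

(** * Tonelli's theorem under a graph, and dilations of the line *)

Section integrals.
Context {R : realType}.
Notation mu := (@lebesgue_measure R).
Local Open Scope ereal_scope.

(** The factor [2(n-1)] in [S] is the denominator of the integral of [(1 - x^2)^(n-2) x] over []a,
    1[], and the substitution [v = s^2] is the source of [lambda = 2 * alpha]. For functions related
    in this way the three conclusions bound the same number up to explicit constants, because each
    half-line weight comes from a tail integral of the preceding one, just as for the kernels on
    []0, 1[].

    The obstacle in the return from [q] to [S] is regularity: in the variable [ln t], [q] is up to a
    factor a second derivative of [S], whereas convexity supplies only one-sided first derivatives,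
    possibly with jumps. Two difference quotients replace the two derivatives. Convexity with
    respect to log enters twice: it makes the first quotient nondecreasing, which gives both
    [q >= 0] and the comparison for the second quotient, and it makes [S], hence [q], continuous
    away from 0. At 0 the factor [1 / v] in [q] would be singular. The hypothesis forces [S] to tend
    to 0 there, so [max (S - d) 0] vanishes near 0; cutting at a height, rather than at a point,
    preserves monotonicity and convexity. *)

Lemma ge0_tonelli_section (A B : set R) (E : set (R * R)) (f k : R -> \bar R) :
  measurable A -> measurable B -> measurable E ->
  measurable_fun A k -> measurable_fun B f ->
  (forall x, A x -> 0 <= k x) -> (forall y, B y -> 0 <= f y) ->
  \int[mu]_(x in A) (k x * \int[mu]_(y in B `&` xsection E x) f y) =
  \int[mu]_(y in B) (f y * \int[mu]_(x in A `&` ysection E y) k x).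
Proof.
move=> mA mB mE mk mf k0 f0.
pose kA := k \_ A; pose fB := f \_ B.
have mkA : measurable_fun setT kA by apply/(measurable_restrictT _ _).1.
have mfB : measurable_fun setT fB by apply/(measurable_restrictT _ _).1.
have kA0 x : 0 <= kA x by apply: erestrict_ge0.
have fB0 x : 0 <= fB x by apply: erestrict_ge0.
(* Both sides are iterated integrals of this zero extension of the product; only the order of
   integration differs. *)
pose G := (fun p : R * R => kA p.1 * fB p.2) \_ E.
have mG : measurable_fun setT G.
  apply/(measurable_restrictT _ _).1 => //.
  apply: measurable_funTS; apply: emeasurable_funM.
  - exact: (measurableT_comp mkA measurable_fst).
  - exact: (measurableT_comp mfB measurable_snd).
have G0 p : 0 <= G p by apply: erestrict_ge0 => q _; exact: mule_ge0.
have -> : \int[mu]_(x in A) (k x * \int[mu]_(y in B `&` xsection E x) f y) =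
    \int[mu]_x \int[mu]_y G (x, y).
  rewrite integral_mkcond; apply: eq_integral => x _.
  transitivity (kA x * \int[mu]_y (f \_ (B `&` xsection E x)) y).
    rewrite -integral_mkcond /kA !patchE; case: ifPn => //; by rewrite mul0e.
  rewrite -ge0_integralZl//; last 2 first.
  - apply/(measurable_restrictT _ _).1.
      by apply: measurableI => //; exact: measurable_xsection.
    exact: measurable_funS mf.
  - by move=> y _; apply: erestrict_ge0 => z [Bz _]; exact: f0.
  apply: eq_integral => y _; rewrite /G /fB !patchE/=.
  rewrite in_setI mem_xsection.
  by case: (y \in B); case: ((x, y) \in E); rewrite ?mule0.
rewrite (@fubini_tonelli _ _ _ _ _ mu mu G)//.
rewrite [RHS]integral_mkcond; apply: eq_integral => y _.
transitivity (fB y * \int[mu]_x (k \_ (A `&` ysection E y)) x); last first.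
  rewrite -integral_mkcond /fB !patchE; case: ifPn => //; by rewrite mul0e.
rewrite -ge0_integralZl//; last 2 first.
- apply/(measurable_restrictT _ _).1.
    by apply: measurableI => //; exact: measurable_ysection.
  exact: measurable_funS mk.
- by move=> x _; apply: erestrict_ge0 => z [Bz _]; exact: k0.
apply: eq_integral => x _; rewrite /G /kA !patchE/=.
rewrite in_setI mem_ysection [RHS]muleC.
by case: (x \in A); case: ((x, y) \in E); rewrite ?mule0 ?mul0e.
Qed.

(* Allowing [phi] to be nonlinear makes the substitution [t = x ^+ 2] between
   the first two assertions unnecessary. *)
Lemma ge0_tonelli_subgraph (A B : set R) (phi : R -> R) (I J : R -> set R)
    (f k : R -> \bar R) :
  measurable A -> measurable B -> measurable_fun setT phi ->
  measurable_fun A k -> measurable_fun B f ->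
  (forall x, A x -> 0 <= k x) -> (forall y, B y -> 0 <= f y) ->
  (forall x, A x -> I x = B `&` [set y | (y < phi x)%R]) ->
  (forall y, B y -> J y = A `&` [set x | (y < phi x)%R]) ->
  \int[mu]_(x in A) (k x * \int[mu]_(y in I x) f y) =
  \int[mu]_(y in B) (f y * \int[mu]_(x in J y) k x).
Proof.
move=> mA mB mphi mk mf k0 f0 HI HJ.
pose E := [set p : R * R | (p.2%:E < (phi p.1)%:E)].
have mE : measurable E.
  rewrite -[E]setTI; apply: measurable_lte => //.
  - by apply/measurable_EFinP; exact: measurable_snd.
  - by apply/measurable_EFinP; exact: (measurableT_comp mphi measurable_fst).
have Ex x : xsection E x = [set y | (y < phi x)%R].
  by apply/seteqP; split => y; rewrite /xsection/E/= inE/= lte_fin.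
have Ey y : ysection E y = [set x | (y < phi x)%R].
  by apply/seteqP; split => x; rewrite /ysection/E/= inE/= lte_fin.
transitivity (\int[mu]_(x in A) (k x * \int[mu]_(y in B `&` xsection E x) f y)).
  by apply: eq_integral => x /set_mem Ax; rewrite Ex HI.
rewrite (@ge0_tonelli_section A B E f k mA mB mE mk mf k0 f0).
by apply: eq_integral => y /set_mem By; rewrite Ey HJ.
Qed.

(** By uniqueness of Lebesgue measure: [t] times the image measure gives each half-open interval its
    length. *)
Lemma lebesgue_measure_scale (t : R) (A : set R) : (0 < t)%R -> measurable A ->
  pushforward mu ( *%R t : _ -> measurableTypeR R) A = (t^-1)%:E * mu A.
Proof.
move=> t0 mA.
have t'0 : (0 <= t)%R by exact: ltW.
have mt : measurable_fun setT ( *%R t : R -> measurableTypeR R).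
  exact: measurable_funM.
transitivity ((t^-1)%:E * (t%:E * pushforward mu ( *%R t : _ -> measurableTypeR R) A)).
  by rewrite muleA -EFinM mulVf ?gt_eqF// mul1e.
congr (_ * _).
pose nu := mscale (NngNum t'0) (pushforward mu ( *%R t : R -> measurableTypeR R)).
rewrite -[LHS]/(nu mt A).
apply/esym/lebesgue_measure_unique => //= _ [[a b]] _ <-.
rewrite /nu /mscale/= /pushforward.
have -> : *%R t @^-1` `]a, b]%classic = `](a / t)%R, (b / t)%R]%classic.
  apply/seteqP; split => x/=; rewrite !in_itv/= ltr_pdivrMr// ler_pdivlMr//;
  by rewrite (mulrC x).
rewrite !lebesgue_measure_itv/= !lte_fin ltr_pM2r ?invr_gt0//.
case: ifPn => _; last by rewrite mule0.
by rewrite -!EFinB -mulrBl -EFinM mulrCA mulfV ?mulr1// gt_eqF.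
Qed.

Lemma ge0_integral_scale (t b : R) (f : R -> \bar R) : (0 < t)%R ->
  measurable_fun `]0%R, (t * b)%R[ f ->
  (forall x, x \in `]0%R, (t * b)%R[ -> 0 <= f x) ->
  \int[mu]_(x in `]0%R, b[) f (t * x)%R =
  (t^-1)%:E * \int[mu]_(x in `]0%R, (t * b)%R[) f x.
Proof.
move=> t0 mf f0.
have mt : measurable_fun setT ( *%R t : R -> measurableTypeR R).
  exact: measurable_funM.
have ti0 : (0 <= t^-1)%R by rewrite invr_ge0 ltW.
have -> : `]0%R, b[%classic = ( *%R t : _ -> measurableTypeR R) @^-1` `]0%R, (t * b)%R[.
  by apply/seteqP; split => x/=; rewrite !in_itv/= ltr_pM2l// pmulr_rgt0.
rewrite -ge0_integral_pushforward//=; last first.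
  by move=> x; rewrite inE/=; exact: f0.
rewrite -(@ge0_integral_mscale _ _ _ lebesgue_measure _ _ (NngNum ti0))//.
by apply: eq_measure_integral => //= A mA _; exact: lebesgue_measure_scale.
Qed.

End integrals.

(** * Explicit integrals *)

Section ftc.
Context {R : realType}.
Notation mu := (@lebesgue_measure R).

Lemma continuous_measurable_itv (f : R -> R) (i : interval R) :
  {in i, continuous f} -> measurable_fun [set` i] f.
Proof.
move=> cf; apply: subspace_continuous_measurable_fun => //.
by apply: continuous_in_subspaceT => x; rewrite inE/=; exact: cf.
Qed.

Lemma integral_oo_is_derive (f F : R -> R) (a b : R) : a < b ->
  (forall x, a <= x <= b -> {for x, continuous f}) ->
  (forall x, a <= x <= b -> is_derive x 1 F (f x)) ->
  (\int[mu]_(x in `]a, b[) (f x)%:E = (F b - F a)%:E)%E.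
Proof.
move=> ab cf dF.
have cF x : a <= x <= b -> {for x, continuous F}.
  move=> xab; apply: differentiable_continuous; apply/derivable1_diffP.
  by have [] := dF x xab.
have mf : measurable_fun `[a, b]%classic (EFin \o f).
  apply/measurable_EFinP; apply: continuous_measurable_itv => x.
  by rewrite in_itv/=; exact: cf.
rewrite integral_itv_bndo_bndc; last first.
  by apply: measurable_funS mf => // x/=; rewrite !in_itv/= => /andP[/ltW-> /ltW->].
rewrite integral_itv_obnd_cbnd; last first.
  by apply: measurable_funS mf => // x/=; rewrite !in_itv/= => /andP[/ltW-> ->].
rewrite (@continuous_FTC2 _ _ F)//.
- apply: continuous_in_subspaceT => x; rewrite inE/= in_itv/=; exact: cf.
- split.
  + move=> x; rewrite in_itv/= => /andP[ax xb].
    by have [] := dF x; rewrite ?(ltW ax) ?(ltW xb).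
  + apply: cvg_at_right_filter; apply: cF; by rewrite lexx ltW.
  + apply: cvg_at_left_filter; apply: cF; by rewrite lexx ltW.
- move=> x; rewrite in_itv/= => /andP[ax xb].
  rewrite derive1E; apply: derive_val; apply: dF.
  by rewrite (ltW ax) (ltW xb).
Qed.

Lemma integral_oy_is_derive (f F : R -> R) (a l : R) :
  (forall x, a <= x -> 0 <= f x) ->
  (forall x, a <= x -> {for x, continuous f}) ->
  (forall x, a <= x -> is_derive x 1 F (f x)) ->
  F x @[x --> +oo] --> l ->
  (\int[mu]_(x in `]a, +oo[) (f x)%:E = (l - F a)%:E)%E.
Proof.
move=> f0 cf dF Fl.
have mf : measurable_fun `[a, +oo[%classic (EFin \o f).
  apply/measurable_EFinP; apply: continuous_measurable_itv => x.
  by rewrite in_itv/= andbT; exact: cf.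
rewrite integral_itv_obnd_cbnd; last first.
  by apply: measurable_funS mf => // x/=; rewrite !in_itv/= => /andP[/ltW->].
rewrite (@ge0_continuous_FTC2y _ _ F _ l)//.
- apply: continuous_in_subspaceT => x; rewrite inE/= in_itv/= andbT; exact: cf.
- by move=> x /ltW ax; have [] := dF x ax.
- apply: cvg_at_right_filter; apply: differentiable_continuous.
  by apply/derivable1_diffP; have [] := dF a (lexx a).
- move=> x; rewrite in_itv/= andbT => /ltW ax.
  by rewrite derive1E; apply: derive_val; apply: dF.
Qed.


Lemma integral_inv_oo (a b : R) : 0 < a -> a < b ->
  (\int[mu]_(x in `]a, b[) (x^-1)%:E = (ln b - ln a)%:E)%E.
Proof.
move=> a0 ab.
have c x : a <= x <= b -> {for x, continuous (@GRing.inv R)}.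
  by move=> /andP[ax _]; apply: inv_continuous; rewrite gt_eqF// (lt_le_trans a0).
have d x : a <= x <= b -> is_derive x 1 (@ln R) x^-1.
  by move=> /andP[ax _]; apply: is_derive1_ln; rewrite (lt_le_trans a0).
exact: integral_oo_is_derive ab c d.
Qed.

Lemma is_derive1_expr (m : nat) (g : R -> R) (x dg : R) : is_derive x 1 g dg ->
  is_derive x 1 (fun y => g y ^+ m) (m%:R * g x ^+ m.-1 * dg).
Proof. by move=> dx; have := is_deriveX m dx; rewrite exprfctE. Qed.

Lemma integral_onem_expr (m : nat) (a : R) : a < 1 ->
  (\int[mu]_(x in `]a, 1%R[) (m.+1%:R * (1 - x) ^+ m)%:E = ((1 - a) ^+ m.+1)%:E)%E.
Proof.
move=> a1.
have c x : a <= x <= 1 -> {for x, continuous (fun x : R => m.+1%:R * (1 - x) ^+ m)}.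
  move=> _; apply: cvgM; first exact: cvg_cst.
  apply: (@continuous_comp _ _ _ (fun x : R => 1 - x) (fun x => x ^+ m)).
    by apply: cvgB; [exact: cvg_cst|exact: cvg_id].
  exact: exprn_continuous.
have d x : a <= x <= 1 -> is_derive x 1 (fun x : R => - (1 - x) ^+ m.+1) (m.+1%:R * (1 - x) ^+ m).
  move=> _.
  have d1 : is_derive x 1 (fun x : R => 1 - x) (0 - 1) by exact: is_deriveB.
  have d2 := is_derive1_expr m.+1 d1.
  by apply: is_derive_eq; rewrite sub0r mulrN1 opprK.
rewrite (integral_oo_is_derive a1 c d).
by rewrite subrr expr0n/= oppr0 sub0r opprK.
Qed.

Lemma integral_onem_sqr_expr (m : nat) (a : R) : 0 <= a < 1 ->
  (\int[mu]_(x in `]a, 1%R[) ((1 - x ^+ 2) ^+ m * x)%:E =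
    ((1 - a ^+ 2) ^+ m.+1 / (2 * m.+1%:R))%:E)%E.
Proof.
move=> /andP[a0 a1].
have c x : a <= x <= 1 -> {for x, continuous (fun x : R => (1 - x ^+ 2) ^+ m * x)}.
  move=> _; apply: cvgM; last exact: cvg_id.
  apply: (@continuous_comp _ _ _ (fun x : R => 1 - x ^+ 2) (fun x => x ^+ m)).
    by apply: cvgB; [exact: cvg_cst|exact: exprn_continuous].
  exact: exprn_continuous.
have d x : a <= x <= 1 ->
    is_derive x 1 (fun x : R => - (2 * m.+1%:R)^-1 * (1 - x ^+ 2) ^+ m.+1)
      ((1 - x ^+ 2) ^+ m * x).
  move=> _.
  have d0 := is_derive1_expr 2 (is_derive_id x (1 : R)).
  have d1 : is_derive x 1 (fun x : R => 1 - x ^+ 2) (0 - 2%:R * x ^+ 1 * 1).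
    exact: is_deriveB.
  have d2 := is_derive1_expr m.+1 d1.
  have d3 := is_deriveZ (- (2 * m.+1%:R)^-1) d2.
  apply: is_derive_eq; rewrite /GRing.scale/=.
  by field; rewrite (_ : 1 + m%:R = m.+1%:R) ?pnatr_eq0// mulrS.
rewrite (integral_oo_is_derive a1 c d).
by rewrite expr1n subrr expr0n/= mulr0 sub0r mulNr opprK mulrC.
Qed.

Lemma cvg_powRy (p : R) : 0 < p -> x `^ p @[x --> +oo] --> +oo.
Proof.
move=> p0; apply/cvgryPge => A.
near=> x.
have x0 : 0 <= x by near: x; apply: nbhs_pinfty_ge; exact: num_real.
have [A0|A0] := leP A 0; first by rewrite (le_trans A0)// powR_ge0.
have -> : A = (A `^ p^-1) `^ p by rewrite -powRrM mulVf ?gt_eqF// powRr1// ltW.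
apply: ge0_ler_powR; rewrite ?nnegrE ?powR_ge0 ?(ltW p0)//.
Unshelve. all: by end_near. 
Unshelve. all: by end_near. Qed.

Lemma continuous_powR (p x : R) : 0 < x -> {for x, continuous (@powR R ^~ p)}.
Proof.
move=> x0; apply: differentiable_continuous; apply/derivable1_diffP.
by apply: derivable_powR; rewrite in_itv/= x0.
Qed.

(** The integrand is the derivative of [- p^-1 / (1 + x^p)], which vanishes at infinity. With
    [p = 2 * lambda] it is the weight of the first assertion. *)
Lemma integral_powR_div_sqr (p a : R) : 0 < p -> 0 < a ->
  (\int[mu]_(x in `]a, +oo[) (x `^ (p - 1) / (1 + x `^ p) ^+ 2)%:E =
    (p^-1 * (1 + a `^ p)^-1)%:E)%E.
Proof.
move=> p0 a0.
have h (x : R) : 0 < 1 + x `^ p by rewrite ltr_pwDl// powR_ge0.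
have cp x : a <= x -> {for x, continuous (fun x : R => 1 + x `^ p)}.
  move=> ax; apply: cvgD; [exact: cvg_cst|apply: continuous_powR].
  exact: lt_le_trans ax.
have f0 x : a <= x -> 0 <= x `^ (p - 1) / (1 + x `^ p) ^+ 2.
  by move=> _; rewrite divr_ge0 ?powR_ge0 ?sqr_ge0.
have c x : a <= x -> {for x, continuous (fun x : R => x `^ (p - 1) / (1 + x `^ p) ^+ 2)}.
  move=> ax; apply: cvgM; first exact: continuous_powR (lt_le_trans a0 ax).
  apply: cvgV; first by rewrite expf_neq0// gt_eqF.
  apply: (@continuous_comp _ _ _ (fun x : R => 1 + x `^ p) (fun x => x ^+ 2)).
    exact: cp.
  exact: exprn_continuous.
have d x : a <= x ->
    is_derive x 1 (fun x : R => - p^-1 * (1 + x `^ p)^-1)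
      (x `^ (p - 1) / (1 + x `^ p) ^+ 2).
  move=> ax.
  have d1 := is_derive1_powR p (lt_le_trans a0 ax).
  have d2 : is_derive x 1 (fun x : R => (1 + x `^ p)^-1)
      (- (1 + x `^ p) ^- 2 *: (0 + p * x `^ (p - 1))).
    by apply: is_deriveV; rewrite gt_eqF.
  have d3 := is_deriveZ (- p^-1) d2.
  apply: is_derive_eq; rewrite /GRing.scale/=; field.
  by rewrite gt_eqF//= gt_eqF.
have l : - p^-1 * (1 + x `^ p)^-1 @[x --> +oo] --> - p^-1 * 0.
  apply: cvgM; first exact: cvg_cst.
  apply/gtr0_cvgV0; first by near=> x.
  apply: (@ger_cvgy _ _ _ _ _ _ _ (cvg_powRy p0)).
  by near=> x; rewrite lerDr.
rewrite (integral_oy_is_derive f0 c d l).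
by rewrite mulr0 sub0r mulNr opprK.
Unshelve. all: by end_near. Qed.

(** Rewritten as [x^(-p-1) / (1 + x^(-p))], the integrand is [- p^-1] times the logarithmic
    derivative of [1 + x^(-p)]. This is where the logarithm of the third assertion comes from. *)
Lemma integral_inv_powR (p a : R) : 0 < p -> 0 < a ->
  (\int[mu]_(x in `]a, +oo[) (x^-1 * (1 + x `^ p)^-1)%:E =
    (p^-1 * ln (1 + 1 / a `^ p))%:E)%E.
Proof.
move=> p0 a0.
have h (x : R) : 0 < 1 + x `^ p by rewrite ltr_pwDl// powR_ge0.
have h' (x : R) : 0 < 1 + x `^ (- p) by rewrite ltr_pwDl// powR_ge0.
have f0 x : a <= x -> 0 <= x^-1 * (1 + x `^ p)^-1.
  by move=> ax; rewrite mulr_ge0// invr_ge0 ltW// (lt_le_trans a0).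
have c x : a <= x -> {for x, continuous (fun x : R => x^-1 * (1 + x `^ p)^-1)}.
  move=> ax; have x0 := lt_le_trans a0 ax.
  apply: cvgM; first by apply: inv_continuous; rewrite gt_eqF.
  apply: cvgV; first by rewrite gt_eqF.
  by apply: cvgD; [exact: cvg_cst|exact: continuous_powR].
have d x : a <= x ->
    is_derive x 1 (fun x : R => - p^-1 * ln (1 + x `^ (- p)))
      (x^-1 * (1 + x `^ p)^-1).
  move=> ax; have x0 := lt_le_trans a0 ax.
  have d1 := is_derive1_powR (- p) x0.
  have d2 : is_derive x 1 (fun x : R => 1 + x `^ (- p)) (0 + - p * x `^ (- p - 1)).
    exact: is_deriveD.
  have d3 := @is_derive1_comp _ (@ln R) (fun x : R => 1 + x `^ (- p)) x _ _
    (is_derive1_ln (h' x)) d2.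
  have d4 := is_deriveZ (- p^-1) d3.
  apply: is_derive_eq.
  have E : x `^ (- p - 1) = (x `^ p)^-1 / x.
    rewrite powRB; first by rewrite powRN powRr1// ltW.
    by rewrite (gt_eqF x0) implybT.
  rewrite /GRing.scale/= E powRN.
  have := powR_gt0 p x0; move: (x `^ p) => y y0; field.
  by rewrite !gt_eqF//= addr_gt0.
have l : - p^-1 * ln (1 + x `^ (- p)) @[x --> +oo] --> - p^-1 * ln (1 + 0).
  apply: cvgM; first exact: cvg_cst.
  apply: (@cvg_comp _ _ _ (fun x : R => 1 + x `^ (- p)) (@ln R) _ (nbhs (1 + 0 : R))); last first.
    by apply: continuous_ln; rewrite addr0.
  apply: cvgD; first exact: cvg_cst.
  under eq_fun do rewrite powRN.
  apply/gtr0_cvgV0; last exact: cvg_powRy.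
  near=> x; apply: powR_gt0; near: x; apply: nbhs_pinfty_gt; exact: num_real.
rewrite (integral_oy_is_derive f0 c d l).
by rewrite addr0 ln1 mulr0 sub0r mulNr opprK powRN div1r.
Unshelve. all: by end_near. Qed.

(** For [p < 1] the integrand is unbounded at 0, so the fundamental theorem is applied on []x / (k +
    2), x[] and monotone convergence gives the rest. The shift by 2 keeps the left endpoint strictly
    below [x] for every [k]. *)
Lemma integral_powR (p x : R) : 0 < p -> 0 < x ->
  (\int[mu]_(y in `]0%R, x[) (p * y `^ (p - 1))%:E = (x `^ p)%:E)%E.
Proof.
move=> p0 x0.
pose f y : R := p * y `^ (p - 1).
pose a_ (k : nat) : R := x / k.+2%:R.
have a0 k : 0 < a_ k by rewrite divr_gt0.
have ax k : a_ k < x by rewrite ltr_pdivrMr// ltr_pMr// ltr1n.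
have cf y : 0 < y -> {for y, continuous f}.
  by move=> y0; apply: cvgM; [exact: cvg_cst|exact: continuous_powR].
have F k : (\int[mu]_(y in `]a_ k, x[) (f y)%:E = (x `^ p - a_ k `^ p)%:E)%E.
  have c y : a_ k <= y <= x -> {for y, continuous f}.
    by move=> /andP[ay _]; apply: cf; exact: lt_le_trans ay.
  have d y : a_ k <= y <= x -> is_derive y 1 (@powR R ^~ p) (f y).
    by move=> /andP[ay _]; apply: is_derive1_powR; exact: lt_le_trans ay.
  by rewrite (integral_oo_is_derive (ax k) c d).
have a_cvg : a_ k @[k --> \oo] --> 0.
  rewrite -[X in _ --> X](mulr0 x); apply: cvgM; first exact: cvg_cst.
  by have := @cvg_harmonic R; rewrite -(cvg_shiftS (@harmonic R)).
have U : `]0, x[%classic = \bigcup_k `]a_ k, x[%classic.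
  apply/seteqP; split => y/=.
    rewrite in_itv/= => /andP[y0 yx].
    have [N _ HN] : \forall k \near \oo, a_ k < y by exact: (cvgr_lt 0).
    by exists N => //=; rewrite in_itv/= yx andbT; apply: HN => /=.
  by move=> [k _]; rewrite /= !in_itv/= => /andP[ay ->]; rewrite andbT (lt_trans (a0 k)).
have mf k : measurable_fun `]a_ k, x[%classic (EFin \o f).
  apply/measurable_EFinP; apply: continuous_measurable_itv => y.
  rewrite in_itv/= => /andP[ay _]; apply: cf; exact: lt_trans ay.
have L : (\int[mu]_(y in `]a_ k, x[) (f y)%:E)%E @[k --> \oo] -->
    (\int[mu]_(y in \bigcup_k `]a_ k, x[%classic) (f y)%:E)%E.
  apply: ge0_nondecreasing_set_cvg_integral => //.
  - move=> i j ij; apply/subsetPset => y/=; rewrite !in_itv/= => /andP[ay ->].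
    rewrite andbT (le_lt_trans _ ay)// ler_wpM2l ?(ltW x0)//.
    by rewrite lef_pV2 ?posrE// ler_nat.
  - by move=> i y _; rewrite lee_fin mulr_ge0 ?powR_ge0// ltW.
rewrite U; move/cvg_lim : L => <-//.
apply/cvg_lim => //.
under eq_fun do rewrite F.
apply: cvg_EFin; first by near=> k.
rewrite /comp/= -[X in _ --> X]subr0; apply: cvgB; first exact: cvg_cst.
(* The limit of the power at 0 is one-sided, so the positivity of [a_ k] matters here. *)
apply: (@cvg_comp _ _ _ a_ (@powR R ^~ p) _ (0^'+)); last exact: powR_cvg0.
move=> A /= [e e0 HA]; near=> k; apply: HA => //=.
by near: k; move/cvgrPdist_lt : a_cvg; apply.
Unshelve. all: by end_near. Qed.

End ftc.

(** * The transforms [q |-> \int_0^t q] and [h |-> \int_0^t h(v) dv/v] *)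

Section transforms.
Context {R : realType}.
Notation mu := (@lebesgue_measure R).
Local Open Scope ereal_scope.
Local Notation I01 := (`]0%R, 1%R[%classic : set R).
Local Notation Rpos := (`]0%R, +oo[%classic : set R).

Lemma measurable_fun_scale (f : R -> \bar R) (t : R) : (0 < t)%R ->
  measurable_fun Rpos f -> measurable_fun Rpos (fun x => f (t * x)%R).
Proof.
move=> t0 mf.
apply: (@measurable_comp _ _ _ _ _ _ Rpos f _ ( *%R t)) => //.
by move=> _ [x /= + <-]; rewrite !in_itv/= !andbT; exact: mulr_gt0.
Qed.

Lemma measurable_inv_oy : measurable_fun Rpos (fun v : R => (v^-1)%:E).
Proof.
apply/measurable_EFinP; apply: continuous_measurable_itv => x.
by rewrite in_itv/= andbT => x0; apply: inv_continuous; rewrite gt_eqF.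
Qed.

Lemma measurable_line_weight (p : R) :
  measurable_fun Rpos (fun t : R => t `^ (p - 1) / (1 + t `^ p) ^+ 2)%R.
Proof.
apply: continuous_measurable_itv => x; rewrite in_itv/= andbT => x0.
apply: cvgM; first exact: continuous_powR.
apply: cvgV; first by rewrite gt_eqF// exprn_gt0// ltr_pwDl// powR_ge0.
apply: (@continuous_comp _ _ _ (fun x : R => 1 + x `^ p)%R (fun x => x ^+ 2)%R).
  by apply: cvgD; [exact: cvg_cst|exact: continuous_powR].
exact: exprn_continuous.
Qed.

Lemma measurable_log_weight (p : R) :
  measurable_fun Rpos (fun x : R => (x^-1 * (1 + x `^ p)^-1)%:E).
Proof.
apply/measurable_EFinP; apply: continuous_measurable_itv => x.
rewrite in_itv/= andbT => x0; apply: cvgM.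
  by apply: inv_continuous; rewrite gt_eqF.
apply: cvgV; first by rewrite gt_eqF// ltr_pwDl// powR_ge0.
by apply: cvgD; [exact: cvg_cst|exact: continuous_powR].
Qed.

Lemma log_weight_ge0 (p x : R) : (0 < x)%R ->
  0 <= (x^-1 * (1 + x `^ p)^-1)%:E :> \bar R.
Proof.
by move=> x0; rewrite lee_fin mulr_ge0 ?invr_ge0 ?(ltW x0)// addr_ge0// powR_ge0.
Qed.

Lemma measurable_disk_weight (m : nat) :
  measurable_fun I01 (fun x : R => (1 - x ^+ 2) ^+ m * x)%R.
Proof.
apply: measurable_funM => //.
by apply: measurable_funX; apply: measurable_funB => //; exact: measurable_funX.
Qed.

Lemma disk_weight_ge0 (m : nat) (x : R) : I01 x -> (0 <= (1 - x ^+ 2) ^+ m * x)%R.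
Proof.
rewrite /= in_itv/= => /andP[x0 x1]; rewrite mulr_ge0 ?(ltW x0)// exprn_ge0//.
by rewrite subr_ge0 expr_le1// ltW.
Qed.

Lemma sub_itv_oy (a b : R) : (0 <= a)%R -> `]a, b[%classic `<=` Rpos.
Proof.
by move=> a0 x; rewrite /= !in_itv/= => /andP[ax _]; rewrite andbT (le_lt_trans a0).
Qed.

Definition log_prim (h : R -> \bar R) (t : R) : \bar R :=
  \int[mu]_(v in `]0%R, t[) ((v^-1)%:E * h v).

(** The measure [dv / v] is invariant under dilations. *)
Lemma log_prim_scale (h : R -> \bar R) (t b : R) : (0 < t)%R ->
  measurable_fun Rpos h -> (forall x, (0 < x)%R -> 0 <= h x) ->
  log_prim (fun v => h (t * v)%R) b = log_prim h (t * b)%R.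
Proof.
move=> t0 mh h0; rewrite /log_prim.
have mh' : measurable_fun Rpos (fun v => (v^-1)%:E * h v).
  by apply: emeasurable_funM => //; exact: measurable_inv_oy.
have h'0 x : (0 < x)%R -> 0 <= (x^-1)%:E * h x.
  by move=> x0; rewrite mule_ge0 ?h0// lee_fin invr_ge0 ltW.
transitivity (t%:E * \int[mu]_(v in `]0%R, b[) (((t * v)^-1)%:E * h (t * v)%R)).
  rewrite -ge0_integralZl//.
  - apply: eq_integral => v; rewrite inE/= in_itv/= => /andP[v0 _].
    by rewrite muleA -EFinM invfM mulrA mulfV ?mul1r// gt_eqF.
  - apply: measurable_funS (measurable_fun_scale t0 mh') => //.
    exact: sub_itv_oy.
  - by move=> x; rewrite /= in_itv/= => /andP[x0 _]; apply: h'0; exact: mulr_gt0.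
  - by rewrite lee_fin ltW.
rewrite (@ge0_integral_scale _ t b (fun v => (v^-1)%:E * h v))//.
- by rewrite muleA -EFinM mulfV ?mul1e// gt_eqF.
- by apply: measurable_funS mh' => //; exact: sub_itv_oy.
- by move=> x; rewrite in_itv/= => /andP[x0 _]; exact: h'0.
Qed.

Lemma sqrtr_lt (x y : R) : (0 < x)%R -> (Num.sqrt y < x)%R = (y < x ^+ 2)%R.
Proof.
by move=> x0; rewrite -{1}(gtr0_norm x0) -sqrtr_sqr ltr_sqrt// exprn_gt0.
Qed.

(** Dilation by [t ^+ 2] reduces to the region [v < x ^+ 2]. There Tonelli integrates the disk
    weight over [x] in []sqrt v, 1[], which leaves [(1 - v) ^+ m.+1 / (2 * m.+1)]. *)
Lemma integral_log_prim_disk (m : nat) (h : R -> \bar R) (t : R) : (0 < t)%R ->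
  measurable_fun Rpos h -> (forall x, (0 < x)%R -> 0 <= h x) ->
  \int[mu]_(x in `]0%R, 1%R[)
     (((1 - x ^+ 2) ^+ m * x)%:E * log_prim h ((t * x) ^+ 2)) =
  ((2 * m.+1%:R)^-1)%:E *
  \int[mu]_(x in `]0%R, 1%R[) (h (t ^+ 2 * x)%R * ((1 - x) ^+ m.+1 / x)%:E).
Proof.
move=> t0 mh h0.
have t20 : (0 < t ^+ 2)%R by rewrite exprn_gt0.
have mh' : measurable_fun I01 (fun v => (v^-1)%:E * h (t ^+ 2 * v)%R).
  apply: emeasurable_funM.
    by apply: measurable_funS measurable_inv_oy => //; exact: sub_itv_oy.
  by apply: measurable_funS (measurable_fun_scale t20 mh) => //; exact: sub_itv_oy.
transitivity (\int[mu]_(x in `]0%R, 1%R[) (((1 - x ^+ 2) ^+ m * x)%:E *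
    \int[mu]_(v in `]0%R, (x ^+ 2)%R[) ((v^-1)%:E * h (t ^+ 2 * v)%R))).
  apply: eq_integral => x _; congr (_ * _).
  by rewrite -[RHS]/(log_prim (fun v => h (t ^+ 2 * v)%R) _) log_prim_scale// exprMn.
rewrite (@ge0_tonelli_subgraph _ I01 I01 (fun x => x ^+ 2)%R _
  (fun y => `](Num.sqrt y), 1%R[%classic))//.
- rewrite -ge0_integralZl//.
  + apply: eq_integral => y; rewrite inE/= in_itv/= => /andP[y0 y1].
    rewrite integral_onem_sqr_expr ?sqrtr_ge0/=; last first.
      by rewrite -[ltRHS]sqrtr1 ltr_sqrt// ltr01.
    rewrite sqr_sqrtr ?(ltW y0)// [in RHS]muleCA -EFinM [X in X * _]muleC -muleA -EFinM.
    by congr (_ * _%:E); ring.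
  + apply: emeasurable_funM.
      by apply: measurable_funS (measurable_fun_scale t20 mh) => //; exact: sub_itv_oy.
    apply/measurable_EFinP; apply: measurable_funM.
      by apply: measurable_funX; exact: measurable_funB.
    by apply/measurable_EFinP; apply: measurable_funS measurable_inv_oy => //; exact: sub_itv_oy.
  + move=> x; rewrite /= in_itv/= => /andP[x0 x1].
    rewrite mule_ge0 ?h0 ?mulr_gt0// lee_fin divr_ge0// ?(ltW x0)//.
    by rewrite exprn_ge0// subr_ge0 ltW.
- by apply/measurable_EFinP; exact: measurable_disk_weight.
- by move=> x x01; rewrite lee_fin disk_weight_ge0.
- move=> x; rewrite /= in_itv/= => /andP[x0 x1].
  by rewrite mule_ge0 ?h0 ?mulr_gt0// lee_fin invr_ge0 ltW.
- move=> x; rewrite /= in_itv/= => /andP[x0 x1]; apply/seteqP; split => y/=.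
    rewrite !in_itv/= => /andP[-> yx]; split => //=.
    by rewrite (lt_trans yx)// expr_lt1 ?ltW.
  by rewrite !in_itv/= => -[/andP[-> _] ->].
- move=> y; rewrite /= in_itv/= => /andP[y0 y1].
  apply/seteqP; split => x/=.
    rewrite !in_itv/= => /andP[yx ->]; rewrite andbT.
    have x0 : (0 < x)%R by rewrite (le_lt_trans _ yx)// sqrtr_ge0.
    by rewrite -sqrtr_lt.
  by rewrite !in_itv/= => -[/andP[x0 ->]]; rewrite andbT sqrtr_lt.
Qed.

(** The same exchange on the half-line. The tail of the weight from [sqrt y] has exponent [2 * l]
    evaluated at [sqrt y], that is exponent [l] at [y]. *)
Lemma integral_log_prim_line (l : R) (h : R -> \bar R) : (0 < l)%R ->
  measurable_fun Rpos h -> (forall x, (0 < x)%R -> 0 <= h x) ->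
  \int[mu]_(x in `]0%R, +oo[)
     ((x `^ (2 * l - 1) / (1 + x `^ (2 * l)) ^+ 2)%:E * log_prim h (x ^+ 2)) =
  ((2 * l)^-1)%:E *
  \int[mu]_(x in `]0%R, +oo[) (h x * (x^-1 * (1 + x `^ l)^-1)%:E).
Proof.
move=> l0 mh h0.
have l20 : (0 < 2 * l)%R by rewrite mulr_gt0.
rewrite /log_prim (@ge0_tonelli_subgraph _ Rpos Rpos (fun x => x ^+ 2)%R _
  (fun y => `](Num.sqrt y), +oo[%classic))//.
- rewrite -ge0_integralZl//.
  + apply: eq_integral => y; rewrite inE/= in_itv/= andbT => y0.
    rewrite integral_powR_div_sqr ?sqrtr_gt0//.
    rewrite powRrM -[in X in (1 + (X `^ _) `^ _)%R](powR12_sqrt (ltW y0)).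
    rewrite -[((y `^ 2^-1) `^ 2)%R]powRrM mulVf ?pnatr_eq0// powRr1 ?(ltW y0)//.
    rewrite [in RHS]muleCA -EFinM [X in X * _]muleC -muleA -EFinM.
    by congr (_ * _%:E); ring.
  + by apply: emeasurable_funM => //; exact: measurable_log_weight.
  + move=> x; rewrite /= in_itv/= andbT => x0.
    by rewrite mule_ge0 ?h0 ?log_weight_ge0.
  + by rewrite lee_fin invr_ge0 ltW.
- by apply/measurable_EFinP; exact: measurable_line_weight.
- by apply: emeasurable_funM => //; exact: measurable_inv_oy.
- by move=> x _; rewrite lee_fin divr_ge0 ?powR_ge0 ?sqr_ge0.
- move=> x; rewrite /= in_itv/= andbT => x0.
  by rewrite mule_ge0 ?h0// lee_fin invr_ge0 ltW.
- move=> x; rewrite /= in_itv/= andbT => x0; apply/seteqP; split => y/=.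
    by rewrite !in_itv/= => /andP[-> yx].
  by rewrite !in_itv/= => -[/andP[-> _] ->].
- move=> y; rewrite /= in_itv/= andbT => y0.
  apply/seteqP; split => x/=.
    rewrite !in_itv/= andbT => yx.
    have x0 : (0 < x)%R by rewrite (le_lt_trans _ yx)// sqrtr_ge0.
    by rewrite x0 -sqrtr_lt.
  by rewrite !in_itv/= => -[/andP[x0 _]]; rewrite andbT sqrtr_lt.
Qed.

(** The preimage of an open ray is an interval. *)
Lemma nondecreasing_emeasurable (h : R -> \bar R) :
  {in `[0%R, +oo[ &, {homo h : x y / (x <= y)%R >-> x <= y}} ->
  measurable_fun Rpos h.
Proof.
move=> hh mD; apply: (measurability _ (ErealGenOInfty.measurableE R)) => //.
move=> _ [_ [y ->] <-].
apply: is_interval_measurable => a b /= [].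
rewrite !in_itv/= !andbT => a0 ha [b0 hb] c /andP[ac cb].
have c0 : (0 < c)%R by exact: lt_le_trans ac.
split; rewrite in_itv/= andbT//; apply: (lt_le_trans ha).
by apply: hh; rewrite ?in_itv/= ?andbT// ltW.
Qed.

(** The tail integral decreases in its lower endpoint, so its opposite is measurable by
    monotonicity. *)
Lemma measurable_tail_integral (g : R -> \bar R) :
  measurable_fun I01 g -> (forall x, (0 < x < 1)%R -> 0 <= g x) ->
  measurable_fun I01 (fun x => \int[mu]_(y in `]x, 1%R[) g y).
Proof.
move=> mg g0; pose G x := - \int[mu]_(y in `]x, 1%R[) g y.
rewrite (_ : (fun x => _) = (fun x => - G x)); last first.
  by apply/funext => x; rewrite oppeK.
apply: measurableT_comp => //.
apply: (@measurable_funS _ _ _ _ Rpos) => //; first exact: sub_itv_oy.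
apply: nondecreasing_emeasurable => x y.
rewrite !in_itv/= !andbT => x0 y0 xy; rewrite /G leeN2.
have sub z : (0 <= z)%R -> `]z, 1%R[%classic `<=` I01.
  by move=> z0 w; rewrite /= !in_itv/= => /andP[/(le_lt_trans z0)-> ->].
apply: ge0_subset_integral => //.
- by apply: measurable_funS mg => //; exact: sub.
- by move=> w /(sub _ x0); rewrite /= in_itv/=; exact: g0.
- by move=> z; rewrite /= !in_itv/= => /andP[/(le_lt_trans xy)-> ->].
Qed.

Definition prim (q : R -> \bar R) (t : R) : \bar R := \int[mu]_(v in `]0%R, t[) q v.

(** With [h = prim q] this turns the condition on [h] into the condition on [q]; the factor [t] is
    the difference between the exponents [alpha] and [alpha - 1]. *)
Lemma integral_prim_kernel (q g : R -> \bar R) (t : R) : (0 < t)%R ->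
  measurable_fun Rpos q -> (forall x, (0 < x)%R -> 0 <= q x) ->
  measurable_fun I01 g -> (forall x, (0 < x < 1)%R -> 0 <= g x) ->
  \int[mu]_(x in `]0%R, 1%R[) (prim q (t * x) * g x) =
  t%:E * \int[mu]_(x in `]0%R, 1%R[) ((\int[mu]_(y in `]x, 1%R[) g y) * q (t * x)%R).
Proof.
move=> t0 mq q0 mg g0.
have mq' : measurable_fun I01 (fun v => q (t * v)%R).
  by apply: measurable_funS (measurable_fun_scale t0 mq) => //; exact: sub_itv_oy.
transitivity (\int[mu]_(x in `]0%R, 1%R[) (g x *
    \int[mu]_(v in `]0%R, x[) (t%:E * q (t * v)%R))).
  apply: eq_integral => x; rewrite inE/= in_itv/= => /andP[x0 x1].
  rewrite muleC; congr (_ * _).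
  rewrite ge0_integralZl//; last 3 first.
  - by apply: measurable_funS (measurable_fun_scale t0 mq) => //; exact: sub_itv_oy.
  - by move=> y; rewrite /= in_itv/= => /andP[y0 _]; rewrite q0// mulr_gt0.
  - by rewrite lee_fin ltW.
  rewrite ge0_integral_scale//.
  - by rewrite muleA -EFinM mulfV ?mul1e// gt_eqF.
  - by apply: measurable_funS mq => //; exact: sub_itv_oy.
  - by move=> y; rewrite /= in_itv/= => /andP[y0 _]; exact: q0.
rewrite (@ge0_tonelli_subgraph _ I01 I01 id _ (fun y => `]y, 1%R[%classic))//.
- rewrite -ge0_integralZl//.
  + by apply: eq_integral => y _; rewrite -muleA [X in _ * X]muleC.
  + apply: emeasurable_funM => //.
    exact: measurable_tail_integral.
  + move=> x; rewrite /= in_itv/= => /andP[x0 x1].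
    rewrite mule_ge0 ?q0 ?mulr_gt0//; apply: integral_ge0 => y.
    by rewrite /= in_itv/= => /andP[xy y1]; rewrite g0// y1 (lt_trans x0).
  + by rewrite lee_fin ltW.
- exact: emeasurable_funM.
- move=> x; rewrite /= in_itv/= => /andP[x0 x1].
  by rewrite mule_ge0 ?q0 ?mulr_gt0// lee_fin ltW.
- move=> x; rewrite /= in_itv/= => /andP[x0 x1]; apply/seteqP; split => y/=.
    by rewrite !in_itv/= => /andP[-> yx]; rewrite (lt_trans yx).
  by rewrite !in_itv/= => -[/andP[-> _] ->].
- move=> y; rewrite /= in_itv/= => /andP[y0 y1]; apply/seteqP; split => x/=.
    by rewrite !in_itv/= => /andP[yx ->]; rewrite (lt_trans y0).
  by rewrite !in_itv/= => -[/andP[_ ->] ->].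
Qed.

(** Tonelli on [y < x] replaces the weight by its tail integral, the logarithm. With [p = 2 * alpha]
    the factor [p^-1] turns the bound [pi * alpha] into [pi / 2]. *)
Lemma integral_prim_line (q : R -> \bar R) (p : R) : (0 < p)%R ->
  measurable_fun Rpos q -> (forall x, (0 < x)%R -> 0 <= q x) ->
  \int[mu]_(x in `]0%R, +oo[) (prim q x * (x^-1 * (1 + x `^ p)^-1)%:E) =
  (p^-1)%:E * \int[mu]_(x in `]0%R, +oo[) (q x * (ln (1 + 1 / x `^ p))%:E).
Proof.
move=> p0 mq q0.
have mw := measurable_log_weight p.
under eq_integral do rewrite muleC.
rewrite /prim (@ge0_tonelli_subgraph _ Rpos Rpos id _ (fun y => `]y, +oo[%classic))//.
- rewrite -ge0_integralZl//.
  + apply: eq_integral => y; rewrite inE/= in_itv/= andbT => y0.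
    by rewrite integral_inv_powR// [RHS]muleCA -EFinM.
  + apply: emeasurable_funM => //; apply/measurable_EFinP.
    apply: continuous_measurable_itv => x; rewrite in_itv/= andbT => x0.
    apply: (@continuous_comp _ _ _ (fun x : R => 1 + 1 / x `^ p)%R (@ln R)).
      apply: cvgD; first exact: cvg_cst.
      apply: cvgM; first exact: cvg_cst.
      by apply: cvgV; [rewrite gt_eqF// powR_gt0|exact: continuous_powR].
    by apply: continuous_ln; rewrite ltr_pwDl// divr_ge0// powR_ge0.
  + move=> x; rewrite /= in_itv/= andbT => x0.
    by rewrite mule_ge0 ?q0// lee_fin ln_ge0// lerDl divr_ge0// powR_ge0.
  + by rewrite lee_fin invr_ge0 ltW.
- by move=> x; rewrite /= in_itv/= andbT; exact: log_weight_ge0.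
- by move=> x; rewrite /= in_itv/= andbT; exact: q0.
- move=> x; rewrite /= in_itv/= andbT => x0; apply/seteqP; split => y/=.
    by rewrite !in_itv/= => /andP[-> yx].
  by rewrite !in_itv/= => -[/andP[-> _] ->].
- move=> y; rewrite /= in_itv/= andbT => y0; apply/seteqP; split => x/=.
    by rewrite !in_itv/= !andbT => yx; rewrite (lt_trans y0).
  by rewrite !in_itv/= !andbT => -[].
Qed.

Lemma log_prim_cat (h : R -> \bar R) (a b : R) : (0 < a)%R -> (a < b)%R ->
  measurable_fun Rpos h -> (forall x, (0 < x)%R -> 0 <= h x) ->
  log_prim h b = log_prim h a + \int[mu]_(v in `]a, b[) ((v^-1)%:E * h v).
Proof.
move=> a0 ab mh h0.
have mf : measurable_fun Rpos (fun v => (v^-1)%:E * h v).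
  by apply: emeasurable_funM => //; exact: measurable_inv_oy.
have mfo (c d : R) : (0 <= c)%R -> measurable_fun `]c, d[ (fun v => (v^-1)%:E * h v).
  by move=> c0; apply: measurable_funS mf => //; exact: sub_itv_oy.
rewrite /log_prim [X in X = _]integral_itv_bndo_bndc; last exact: mfo.
rewrite [X in _ = X + _]integral_itv_bndo_bndc; last exact: mfo.
rewrite [X in _ = _ + X]integral_itv_bndo_bndc; last exact: mfo (ltW a0).
rewrite -ge0_integral_setU//.
- by congr integral; rewrite -itv_bndbnd_setU// ?bnd_simp ltW.
- apply: measurable_funS mf => // x [|]/=; rewrite !in_itv/= andbT => /andP[]//.
  by move=> ax _; exact: lt_trans ax.
- move=> x [|]/=; rewrite !in_itv/= => /andP[x0 _].
    by rewrite mule_ge0 ?h0// lee_fin invr_ge0 ltW.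
  by rewrite mule_ge0 ?h0 ?(lt_trans a0)// lee_fin invr_ge0 ltW// (lt_trans a0).
- apply/disj_setPS => x [/=]; rewrite !in_itv/= => /andP[_ xa] /andP[ax _].
  by move: (le_lt_trans xa ax); rewrite ltxx.
Qed.

(** On []a, b[] a nondecreasing [h] stays between [h a] and [h b], and the mass of [dv / v] is
    [ln b - ln a]. In this form [h] acts as the slope of [log_prim h] in the variable [ln t],
    without differentiability. *)
Lemma log_prim_bounds (h : R -> \bar R) (a b : R) : (0 < a)%R -> (a <= b)%R ->
  {in `[0%R, +oo[ &, {homo h : x y / (x <= y)%R >-> x <= y}} ->
  (forall x, (0 <= x)%R -> 0 <= h x) ->
  log_prim h a + h a * (ln b - ln a)%:E <= log_prim h b /\
  log_prim h b <= log_prim h a + h b * (ln b - ln a)%:E.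
Proof.
move=> a0; rewrite le_eqVlt => /predU1P[<- _ _|ab hh h0].
  by rewrite subrr !mule0 adde0.
have mh := nondecreasing_emeasurable hh.
have b0 := lt_trans a0 ab.
rewrite (log_prim_cat a0 ab mh); last by move=> x /ltW; exact: h0.
have mi : measurable_fun `]a, b[ (fun v : R => (v^-1)%:E).
  by apply: measurable_funS measurable_inv_oy => //; apply: sub_itv_oy; exact: ltW.
have mh' : measurable_fun `]a, b[ (fun v => (v^-1)%:E * h v).
  apply: emeasurable_funM => //.
  by apply: measurable_funS mh => //; apply: sub_itv_oy; exact: ltW.
have E c : (0 <= c)%R -> \int[mu]_(v in `]a, b[) ((v^-1)%:E * h c) = h c * (ln b - ln a)%:E.
  move=> c0; rewrite ge0_integralZr// ?h0//; first by rewrite integral_inv_oo// muleC.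
  move=> x; rewrite /= in_itv/= => /andP[ax _].
  by rewrite lee_fin invr_ge0 ltW// (lt_trans a0).
rewrite -!E ?(ltW a0) ?(ltW b0)//; split; apply: leeD2l; apply: ge0_le_integral => //.
- move=> x; rewrite /= in_itv/= => /andP[ax _]; rewrite mule_ge0 ?h0 ?(ltW a0)//.
  by rewrite lee_fin invr_ge0 ltW// (lt_trans a0).
- by apply: emeasurable_funM.
- move=> x; rewrite /= in_itv/= => /andP[ax xb]; have x0 := lt_trans a0 ax.
  apply: lee_wpmul2l; first by rewrite lee_fin invr_ge0 ltW.
  by apply: hh; rewrite ?in_itv/= ?andbT ltW.
- move=> x; rewrite /= in_itv/= => /andP[ax _]; have x0 := lt_trans a0 ax.
  by rewrite mule_ge0 ?h0 ?(ltW x0)// lee_fin invr_ge0 ltW.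
- by apply: emeasurable_funM.
- move=> x; rewrite /= in_itv/= => /andP[ax xb]; have x0 := lt_trans a0 ax.
  apply: lee_wpmul2l; first by rewrite lee_fin invr_ge0 ltW.
  by apply: hh; rewrite ?in_itv/= ?andbT ltW.
Qed.

(* The integral of the increment telescopes to that of [f v / v] over
   [[r * t, t]], an interval of length [- ln r] for the measure [dv / v]. *)
Lemma log_prim_increment (f : R -> R) (r t0 t : R) :
  (0 < r < 1)%R -> (0 < t0)%R -> (0 < t)%R ->
  {homo f : x y / (x <= y)%R} -> (forall x, x <= t0 -> f x = 0)%R ->
  ((f (r * t))%:E <= log_prim (fun v => ((f v - f (r * v)) / - ln r)%:E) t <= (f t)%:E)%E.
Proof.
move=> /andP[r0 r1] t00 tpos fh fz.
have f0 x : (0 <= f x)%R.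
  have [xt|/ltW tx] := leP x t0; first by rewrite fz.
  by rewrite -(fz t0)// fh.
have e0 : (0 < - ln r)%R by rewrite oppr_gt0 ln_lt0// r0.
have rt : (r * t <= t)%R by rewrite ger_pMl// ltW.
have rt0 : (0 < r * t)%R by exact: mulr_gt0.
have mf : measurable_fun Rpos (EFin \o f).
  by apply/measurable_EFinP; exact: nondecreasing_measurable.
have mfr := measurable_fun_scale r0 mf.
have fh' : {in `[0%R, +oo[ &, {homo (EFin \o f) : x y / (x <= y)%R >-> x <= y}}.
  by move=> x y _ _ xy; rewrite lee_fin fh.
have fE0 x : (0 <= x)%R -> 0 <= (EFin \o f) x by rewrite lee_fin.
have [lb ub] := log_prim_bounds rt0 rt fh' fE0.
pose d := fun v => (f v - f (r * v))%:E.
have d0 v : (0 < v)%R -> 0 <= d v.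
  by move=> v0; rewrite lee_fin subr_ge0 fh// ger_pMl// ltW.
have md : measurable_fun Rpos d.
  apply/measurable_EFinP; apply: measurable_funB; exact/measurable_EFinP.
(* This term is cancelled below, which in [\bar R] requires it to be finite. Since [f] vanishes up
   to [t0], the integrand is at most [t0^-1 * f t]. *)
have fin : log_prim (EFin \o f) (r * t) \is a fin_num.
  rewrite ge0_fin_numE; last first.
    apply: integral_ge0 => x; rewrite /= in_itv/= => /andP[x0 _].
    by rewrite mule_ge0 ?lee_fin// invr_ge0 ltW.
  apply: (@le_lt_trans _ _ (\int[mu]_(v in `]0%R, (r * t)%R[) cst (t0^-1 * f t)%:E v)).
    apply: ge0_le_integral => //.
    - move=> x; rewrite /= in_itv/= => /andP[x0 _].
      by rewrite mule_ge0 ?lee_fin// invr_ge0 ltW.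
    - apply: measurable_funS; last exact: emeasurable_funM measurable_inv_oy mf.
      + by [].
      + exact: sub_itv_oy.
    - move=> x; rewrite /= in_itv/= => /andP[x0 xt]; rewrite -EFinM lee_fin.
      have [xt0|/ltW tx] := leP x t0.
        by rewrite fz// mulr0 mulr_ge0// invr_ge0 ltW.
      apply: ler_pM; rewrite ?invr_ge0 ?(ltW x0)//.
        by rewrite lef_pV2 ?posrE.
      by apply: fh; rewrite (le_trans (ltW xt)).
  rewrite integral_cst//= lebesgue_measure_itv/= lte_fin rt0 -EFinB -EFinM.
  by rewrite ltry.
have S : log_prim (EFin \o f) t = log_prim d t + log_prim (EFin \o f) (r * t).
  rewrite -(log_prim_scale _ r0 mf); last by move=> x /ltW; exact: fE0.
  rewrite /log_prim -ge0_integralD//.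
  - apply: eq_integral => v _; rewrite -!EFinM -EFinD; congr (_%:E).
    by rewrite -mulrDr subrK.
  - move=> x; rewrite /= in_itv/= => /andP[x0 _].
    by rewrite mule_ge0 ?d0// lee_fin invr_ge0 ltW.
  - apply: measurable_funS; last exact: emeasurable_funM measurable_inv_oy md.
    + by [].
    + exact: sub_itv_oy.
  - move=> x; rewrite /= in_itv/= => /andP[x0 _].
    by rewrite mule_ge0 ?lee_fin// invr_ge0 ltW.
  - apply: measurable_funS; last exact: emeasurable_funM measurable_inv_oy mfr.
    + by [].
    + exact: sub_itv_oy.
have ln_rt : (ln t - ln (r * t) = - ln r)%R by rewrite lnM ?posrE//; ring.
rewrite ln_rt S in lb ub.
have -> : log_prim (fun v => ((f v - f (r * v)) / - ln r)%:E) t =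
    ((- ln r)^-1)%:E * log_prim d t.
  rewrite /log_prim -ge0_integralZl//.
  - by apply: eq_integral => v _; rewrite /d -!EFinM; congr (_%:E); ring.
  - apply: measurable_funS; last exact: emeasurable_funM measurable_inv_oy md.
    + by [].
    + exact: sub_itv_oy.
  - move=> x; rewrite /= in_itv/= => /andP[x0 _].
    by rewrite mule_ge0 ?d0// lee_fin invr_ge0 ltW.
  - by rewrite lee_fin invr_ge0 ltW.
rewrite [X in X <= _]addeC leeD2rE// in lb.
rewrite [X in _ <= X]addeC leeD2rE// in ub.
have e1 : 0 <= ((- ln r)^-1)%:E by rewrite lee_fin invr_ge0 ltW.
have K (x : R) : x%:E = ((- ln r)^-1)%:E * (x%:E * (- ln r)%:E).
  by rewrite -!EFinM mulrCA mulVf ?mulr1// gt_eqF.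
apply/andP; split.
  by rewrite (K (f (r * t)%R)) lee_wpmul2l.
by rewrite (K (f t)) lee_wpmul2l.
Qed.

End transforms.

(** * Convexity with respect to log of primitives for [dv / v] *)

Section convexity.
Context {R : realType}.
Notation mu := (@lebesgue_measure R).

(** The cases [t = 0] and [t = 1] are trivial. For [0 < t < 1], an argument equal to [-oo] makes the
    whole combination [-oo], so that the left-hand side is [phi 0 = 0]; only real arguments
    remain. *)
Lemma convex_wrt_logI (phi : R -> R) :
  (forall t, 0 <= t -> 0 <= phi t) -> phi 0 = 0 ->
  (forall x y t : R, 0 <= t <= 1 ->
    phi (expR (t * x + (1 - t) * y)) <= t * phi (expR x) + (1 - t) * phi (expR y)) ->
  convex_wrt_log 0%E +oo%E phi.
Proof.
move=> phi0 phi00 cphi x y t /andP[_ xoo] /andP[_ yoo] t01.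
have /andP[t0 t1] := t01.
have pos z : 0 <= phi (fine (expeR z)) by rewrite phi0// fine_ge0// expeR_ge0.
have rhs0 : 0 <= t * phi (fine (expeR x)) + (1 - t) * phi (fine (expeR y)).
  by rewrite addr_ge0// mulr_ge0// subr_ge0.
have [->|t_neq0] := eqVneq t 0; first by rewrite mul0e add0e subr0 mul1e mul0r add0r mul1r.
have [->|t_neq1] := eqVneq t 1; first by rewrite subrr mul0e adde0 mul1e mul0r addr0 mul1r.
have t_gt0 : 0 < t by rewrite lt_neqAle eq_sym t_neq0.
have t_lt1 : 0 < 1 - t by rewrite subr_gt0 lt_neqAle t_neq1.
move: xoo yoo rhs0; case: x => [x| |]; case: y => [y| |] //.
- by move=> _ _ _; exact: cphi.
- by move=> _ _ rhs0; rewrite gt0_muleNy ?lte_fin// addeNy; apply: le_trans rhs0; rewrite /= phi00.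
- by move=> _ _ rhs0; rewrite gt0_muleNy ?lte_fin// addNye; apply: le_trans rhs0; rewrite /= phi00.
- by move=> _ _ rhs0; rewrite gt0_muleNy ?lte_fin// addNye; apply: le_trans rhs0; rewrite /= phi00.
Qed.

Lemma convex_wrt_logE (phi : R -> R) : convex_wrt_log 0%E +oo%E phi ->
  forall x y t : R, 0 <= t <= 1 ->
    phi (expR (t * x + (1 - t) * y)) <= t * phi (expR x) + (1 - t) * phi (expR y).
Proof.
move=> cphi x y t t01; apply: (cphi x%:E y%:E t _ _ t01).
- by rewrite le0_lneNy// leNye/= ltry.
- by rewrite le0_lneNy// leNye/= ltry.
Qed.

Lemma log_prim0 (h : R -> \bar R) (t : R) : t <= 0 -> log_prim h t = 0%E.
Proof.
by move=> t0; rewrite /log_prim set_itv_ge ?bnd_simp -?leNgt// integral_set0.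
Qed.

Lemma log_prim_ge0 (h : R -> \bar R) (t : R) : (forall x, 0 <= x -> (0 <= h x)%E) ->
  (0 <= log_prim h t)%E.
Proof.
move=> h0; apply: integral_ge0 => x; rewrite /= in_itv/= => /andP[/ltW x0 _].
by rewrite mule_ge0 ?h0// lee_fin invr_ge0.
Qed.

Lemma log_prim_le (h : R -> \bar R) (s t : R) : s <= t ->
  {in `[0, +oo[ &, {homo h : x y / x <= y >-> (x <= y)%E}} ->
  (forall x, 0 <= x -> (0 <= h x)%E) ->
  (log_prim h s <= log_prim h t)%E.
Proof.
move=> st hh h0; apply: ge0_subset_integral => //.
- apply: emeasurable_funM.
    by apply: measurable_funS measurable_inv_oy => //; exact: sub_itv_oy.
  by apply: measurable_funS (nondecreasing_emeasurable hh) => //; exact: sub_itv_oy.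
- move=> x; rewrite /= in_itv/= => /andP[/ltW x0 _].
  by rewrite mule_ge0 ?h0// lee_fin invr_ge0.
- by move=> x; rewrite /= !in_itv/= => /andP[-> /lt_le_trans->].
Qed.

(* The value [h w] gives a supporting line at [ln w] for the convex function
   [x |-> log_prim h (expR x)]. *)
Lemma log_prim_supporting_line (h : R -> \bar R) (w z : R) : 0 < w -> 0 < z ->
  {in `[0, +oo[ &, {homo h : x y / x <= y >-> (x <= y)%E}} ->
  (forall x, 0 <= x -> (0 <= h x)%E) ->
  (forall x, log_prim h x \is a fin_num) ->
  fine (log_prim h w) + fine (h w) * (ln z - ln w) <= fine (log_prim h z).
Proof.
move=> w0 z0 hh h0 hfin.
(* [h w] times [ln 2] is at most the finite value [log_prim h (2 * w)]; any point above [w] would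
   serve. *)
have hw : h w \is a fin_num.
  have w2 : w < 2 * w by lra.
  have [+ _] := log_prim_bounds w0 (ltW w2) hh h0.
  rewrite -(fineK (hfin w)) -(fineK (hfin (2 * w))).
  have lw : 0 < ln (2 * w) - ln w by rewrite subr_gt0 ltr_ln ?posrE// mulr_gt0.
  have := h0 w (ltW w0); case: (h w) => // _.
  by rewrite gt0_mulye ?lte_fin// addey.
have [wz|/ltW zw] := leP w z.
  have [+ _] := log_prim_bounds w0 wz hh h0.
  by rewrite -(fineK (hfin w)) -(fineK (hfin z)) -(fineK hw) -EFinM -EFinD lee_fin.
have [_] := log_prim_bounds z0 zw hh h0.
rewrite -(fineK (hfin w)) -(fineK (hfin z)) -(fineK hw) -EFinM -EFinD lee_fin/=.
move: (fine _) (fine _) (fine _) (ln w) (ln z) => a b c d e; lra.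
Qed.

(** The supporting line at the intermediate point bounds both endpoint values from below, and the
    slope terms cancel in the weighted sum. *)
Lemma convex_wrt_log_log_prim (h : R -> \bar R) (c : R) : 0 <= c ->
  {in `[0, +oo[ &, {homo h : x y / x <= y >-> (x <= y)%E}} ->
  (forall x, 0 <= x -> (0 <= h x)%E) ->
  (forall x, log_prim h x \is a fin_num) ->
  convex_wrt_log 0%E +oo%E (fun t => c * fine (log_prim h (t ^+ 2))).
Proof.
move=> c0 hh h0 hfin; apply: convex_wrt_logI.
- by move=> t _; rewrite mulr_ge0// fine_ge0// log_prim_ge0.
- by rewrite expr0n/= log_prim0// mulr0.
move=> x y t /andP[t0 t1].
set w := expR _.
have sq (z : R) : 0 < expR z ^+ 2 by rewrite exprn_gt0// expR_gt0.
have lsq (z : R) : ln (expR z ^+ 2) = 2 * z by rewrite expr2 lnM ?posrE ?expR_gt0// expRK; ring.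
have Lx := log_prim_supporting_line (sq (t * x + (1 - t) * y)) (sq x) hh h0 hfin.
have Ly := log_prim_supporting_line (sq (t * x + (1 - t) * y)) (sq y) hh h0 hfin.
rewrite -/w !lsq in Lx Ly.
rewrite mulrCA [X in _ <= _ + X]mulrCA -mulrDr ler_wpM2l//.
have t1' : 0 <= 1 - t by rewrite subr_ge0.
have := lerD (ler_wpM2l t0 Lx) (ler_wpM2l t1' Ly).
apply: le_trans; rewrite le_eqVlt; apply/orP; left; apply/eqP.
by ring.
Qed.

End convexity.

(** * The implications *)

Section assertions.
Context {R : realType}.
Notation mu := (@lebesgue_measure R).
Implicit Types (n : nat) (alpha lambda : R).

Definition assertion_S n lambda : Prop :=
  forall S : R -> R,
      (forall x, 0 <= x -> 0 <= S x) ->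
      {in `[0, +oo[ &, {homo S : x y / x <= y}} ->
      convex_wrt_log 0%E +oo%E S ->
      (forall t : R, 0 <= t ->
        (\int[lebesgue_measure]_(x in `]0%R, 1%R[)
           (S (t * x) * (1 - x ^+ 2) ^+ (n - 2) * x)%:E
         <= (t `^ lambda)%:E)%E) ->
      (\int[lebesgue_measure]_(t in `]0%R, +oo[)
         (S t * (t `^ (2 * lambda - 1) / (1 + t `^ (2 * lambda)) ^+ 2))%:E
       <= (pi * (n - 1)%:R / (2 * lambda) *
           \prod_(1 <= k < n) (1 + lambda / (2 * k%:R)))%:E)%E.

Definition assertion_h n alpha : Prop :=
  forall h : R -> \bar R,
      (forall x, 0 <= x -> (0 <= h x)%E) ->
      {in `[0, +oo[ &, {homo h : x y / x <= y >-> (x <= y)%E}} ->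
      (forall t : R, 0 <= t ->
        (\int[lebesgue_measure]_(x in `]0%R, 1%R[)
           (h (t * x)%R * ((1 - x) ^+ (n - 1) / x)%:E)
         <= (t `^ alpha)%:E)%E) ->
      (\int[lebesgue_measure]_(t in `]0%R, +oo[)
         (h t * (t^-1 * (1 + t `^ (2 * alpha))^-1)%:E)
       <= (pi / 2 * \prod_(1 <= k < n) (1 + alpha / k%:R))%:E)%E.

Definition assertion_q n alpha : Prop :=
  forall q : R -> R,
      (forall x, 0 <= x -> 0 <= q x) ->
      {within `[0, +oo[, continuous q} ->
      (forall t : R, 0 <= t ->
        (\int[lebesgue_measure]_(x in `]0%R, 1%R[)
           ((\int[lebesgue_measure]_(y in `]x, 1%R[)
               ((1 - y) ^+ (n - 1) / y)%:E) * (q (t * x)%R)%:E)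
         <= powRy t (alpha - 1))%E) ->
      (\int[lebesgue_measure]_(t in `]0%R, +oo[)
         (q t * ln (1 + 1 / t `^ (2 * alpha)))%:E
       <= (pi * alpha * \prod_(1 <= k < n) (1 + alpha / k%:R))%:E)%E.

Lemma measurable_onem_kernel (k : nat) :
  measurable_fun (`]0%R, 1%R[%classic : set R) (fun x => ((1 - x) ^+ k / x)%:E).
Proof.
apply/measurable_EFinP; apply: measurable_funM.
  by apply: measurable_funX; exact: measurable_funB.
apply/measurable_EFinP; apply: measurable_funS measurable_inv_oy => //.
exact: sub_itv_oy.
Qed.

Lemma onem_kernel_ge0 (k : nat) (x : R) : 0 < x < 1 ->
  (0 <= ((1 - x) ^+ k / x)%:E)%E.
Proof.
move=> /andP[x0 x1]; rewrite lee_fin divr_ge0 ?(ltW x0)//.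
by rewrite exprn_ge0// subr_ge0 ltW.
Qed.

(** On []0, 1/2[] the kernel is at least [2^-k / x], so the condition at [2 * T] bounds
    [log_prim h T]. This allows a real-valued [S] to be built from an [h] with values in
    [\bar R]. *)
Lemma log_prim_fin_num (k : nat) (alpha : R) (h : R -> \bar R) :
  (forall x, 0 <= x -> (0 <= h x)%E) ->
  {in `[0, +oo[ &, {homo h : x y / x <= y >-> (x <= y)%E}} ->
  (forall t : R, 0 <= t ->
    (\int[lebesgue_measure]_(x in `]0%R, 1%R[) (h (t * x)%R * ((1 - x) ^+ k / x)%:E)
     <= (t `^ alpha)%:E)%E) ->
  forall T, log_prim h T \is a fin_num.
Proof.
move=> h0 hh cond T.
have [T0|T0] := leP T 0; first by rewrite log_prim0.
have mh := nondecreasing_emeasurable hh.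
have T20 : 0 < 2 * T by lra.
have mh2 := measurable_fun_scale T20 mh.
rewrite ge0_fin_numE ?log_prim_ge0//.
have -> : T = 2 * T * 2^-1 by field.
rewrite -log_prim_scale//; last by move=> x /ltW; exact: h0.
have c0 : 0 < (2^-1 : R) ^+ k by rewrite exprn_gt0.
suff : ((2^-1 ^+ k)%:E * log_prim (fun v => h (2 * T * v)%R) 2^-1 <= ((2 * T) `^ alpha)%:E)%E.
  rewrite -lee_pdivlMl// => /le_lt_trans; apply.
  by rewrite -EFinM ltry.
apply: le_trans (cond (2 * T) (ltW T20)).
have mi : measurable_fun (`]0%R, 2^-1[%classic : set R)
    (fun x => h (2 * T * x)%R * ((1 - x) ^+ k / x)%:E)%E.
  apply: emeasurable_funM.
    by apply: measurable_funS mh2 => //; exact: sub_itv_oy.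
  apply: measurable_funS (measurable_onem_kernel k) => // x.
  by rewrite /= !in_itv/= => /andP[-> /lt_trans->]//; rewrite invf_lt1// ltr1n.
apply: (@le_trans _ _ (\int[mu]_(x in `]0%R, (2^-1)%R[)
    (h (2 * T * x)%R * ((1 - x) ^+ k / x)%:E))%E).
  rewrite /log_prim -ge0_integralZl//.
  - apply: ge0_le_integral => //.
    + move=> x; rewrite /= in_itv/= => /andP[x0 _].
      rewrite !mule_ge0 ?lee_fin ?(ltW c0) ?invr_ge0 ?(ltW x0)//.
      by apply: h0; rewrite mulr_ge0// ltW.
    + apply: emeasurable_funM => //; apply: emeasurable_funM.
        by apply: measurable_funS measurable_inv_oy => //; exact: sub_itv_oy.
      by apply: measurable_funS mh2 => //; exact: sub_itv_oy.
    + move=> x; rewrite /= in_itv/= => /andP[x0 xh].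
      rewrite muleA -EFinM muleC lee_wpmul2l//.
        by apply: h0; rewrite mulr_ge0// ltW.
      rewrite lee_fin ler_wpM2r ?invr_ge0 ?(ltW x0)//.
      by apply: lerXn2r; rewrite ?nnegrE; lra.
  - apply: emeasurable_funM.
      by apply: measurable_funS measurable_inv_oy => //; exact: sub_itv_oy.
    by apply: measurable_funS mh2 => //; exact: sub_itv_oy.
  - move=> x; rewrite /= in_itv/= => /andP[x0 _].
    rewrite mule_ge0 ?lee_fin ?invr_ge0 ?(ltW x0)//.
    by apply: h0; rewrite mulr_ge0// ltW.
apply: ge0_subset_integral => //.
- apply: emeasurable_funM; last exact: measurable_onem_kernel.
  by apply: measurable_funS mh2 => //; exact: sub_itv_oy.
- move=> x; rewrite /= in_itv/= => /andP[x0 x1].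
  rewrite mule_ge0 ?onem_kernel_ge0 ?x0//.
  by apply: h0; rewrite mulr_ge0// ltW.
- move=> x; rewrite /= !in_itv/= => /andP[-> /lt_trans->]//.
  by rewrite invf_lt1// ltr1n.
Qed.

End assertions.

(** * From [S] to [h], from [h] to [q], and the Beta integral *)

Section implications.
Context {R : realType}.
Notation mu := (@lebesgue_measure R).
Implicit Types (n : nat) (alpha lambda : R).

Lemma measurable_log_prim_sqr (h : R -> \bar R) (t : R) (D : set R) :
  0 <= t -> measurable D -> D `<=` `]0, +oo[ ->
  {in `[0, +oo[ &, {homo h : x y / x <= y >-> (x <= y)%E}} ->
  (forall x, 0 <= x -> (0 <= h x)%E) ->
  measurable_fun D (fun x => log_prim h ((t * x) ^+ 2)).
Proof.
move=> t0 mD D0 hh h0; apply: measurable_funS (D0) _ => //.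
apply: nondecreasing_emeasurable => x y; rewrite !in_itv/= !andbT => x0 y0 xy.
by apply: log_prim_le => //; rewrite lerXn2r ?nnegrE ?mulr_ge0// ler_wpM2l.
Qed.

Lemma assertion_S_h n alpha lambda : (2 <= n)%N -> 0 < alpha -> lambda = 2 * alpha ->
  assertion_S n lambda -> assertion_h n alpha.
Proof.
case: n => [|[|m]]// _ alpha0 lE PS h h0 hh cond.
have l0 : 0 < lambda by rewrite lE mulr_gt0.
have hfin := log_prim_fin_num h0 hh cond.
have mh := nondecreasing_emeasurable hh.
have h0' x : 0 < x -> (0 <= h x)%E by move=> /ltW; exact: h0.
(* With [n = m + 2] this is [2(n-1)]. It cancels the denominator produced by the disk integral, so
   the condition on [S] at [t] is exactly the condition on [h] at [t ^+ 2]. *)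
pose c : R := 2 * m.+1%:R.
have c0 : 0 < c by rewrite mulr_gt0.
pose S t := c * fine (log_prim h (t ^+ 2)).
have SE t : (S t)%:E = (c%:E * log_prim h (t ^+ 2))%E by rewrite EFinM fineK.
have S0 t : 0 <= S t by rewrite mulr_ge0 ?(ltW c0)// fine_ge0// log_prim_ge0.
have Sle : {in `[0, +oo[ &, {homo S : x y / x <= y}}.
  move=> x y; rewrite !in_itv/= !andbT => x0 y0 xy; rewrite ler_wpM2l ?(ltW c0)//.
  by rewrite fine_le// log_prim_le// lerXn2r ?nnegrE.
have Scvx : convex_wrt_log 0%E +oo%E S.
  by apply: convex_wrt_log_log_prim => //; exact: ltW.
have Scond (t : R) : 0 <= t ->
    (\int[mu]_(x in `]0%R, 1%R[) (S (t * x) * (1 - x ^+ 2) ^+ (m.+2 - 2) * x)%:E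
     <= (t `^ lambda)%:E)%E.
  rewrite le_eqVlt => /predU1P[<-|t0].
    rewrite integral0_eq ?lee_fin ?powR_ge0// => x _.
    by rewrite mul0r /S expr0n/= log_prim0// mulr0 !mul0r.
  rewrite subn2/=.
  have -> : (\int[mu]_(x in `]0%R, 1%R[) (S (t * x) * (1 - x ^+ 2) ^+ m * x)%:E =
     c%:E * \int[mu]_(x in `]0%R, 1%R[)
       (((1 - x ^+ 2) ^+ m * x)%:E * log_prim h ((t * x) ^+ 2)))%E.
    rewrite -ge0_integralZl//.
    - by apply: eq_integral => x _; rewrite -mulrA EFinM SE -muleA [X in (_ * X)%E]muleC.
    - apply: emeasurable_funM; last first.
        by apply: measurable_log_prim_sqr => //; [exact: ltW|exact: sub_itv_oy].
      by apply/measurable_EFinP; exact: measurable_disk_weight.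
    - by move=> x x01; rewrite mule_ge0 ?log_prim_ge0// lee_fin disk_weight_ge0.
    - by rewrite lee_fin ltW.
  rewrite integral_log_prim_disk// muleA -EFinM mulfV ?gt_eqF// mul1e.
  apply: le_trans (cond (t ^+ 2) (sqr_ge0 t)) _.
  by rewrite lE powRrM (powR_mulrn 2 (ltW t0)).
have := PS S (fun t _ => S0 t) Sle Scvx Scond.
have -> : (\int[mu]_(t in `]0%R, +oo[)
      (S t * (t `^ (2 * lambda - 1) / (1 + t `^ (2 * lambda)) ^+ 2))%:E =
    (c / (2 * lambda))%:E *
    \int[mu]_(t in `]0%R, +oo[) (h t * (t^-1 * (1 + t `^ (2 * alpha))^-1)%:E))%E.
  rewrite -lE EFinM -muleA -integral_log_prim_line// -ge0_integralZl//.
  - by apply: eq_integral => x _; rewrite EFinM SE -muleA [X in (_ * X)%E]muleC.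
  - apply: emeasurable_funM; last first.
      rewrite (_ : (fun x => _) = (fun x : R => log_prim h ((1 * x) ^+ 2))); last first.
        by apply/funext => x; rewrite mul1r.
      exact: measurable_log_prim_sqr.
    by apply/measurable_EFinP; exact: measurable_line_weight.
  - move=> x _; rewrite mule_ge0 ?log_prim_ge0// lee_fin.
    by rewrite divr_ge0 ?powR_ge0 ?sqr_ge0.
  - by rewrite lee_fin ltW.
have cl0 : 0 < c / (2 * lambda) by rewrite divr_gt0// mulr_gt0.
rewrite -lee_pdivlMl// => /le_trans; apply.
rewrite -EFinM lee_fin le_eqVlt; apply/orP; left; apply/eqP.
rewrite subn1/=.
rewrite (eq_big_nat _ _ (F2 := fun k => 1 + alpha / k%:R)); last first.
  by move=> k _; rewrite lE invfM mulrACA mulfV ?mul1r.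
rewrite /c; move: (\prod_(_ <= _ < _) _) => P; field.
by rewrite gt_eqF//= ?pnatr_eq0.
Qed.

Lemma assertion_h_q n alpha : (2 <= n)%N -> 0 < alpha ->
  assertion_h n alpha -> assertion_q n alpha.
Proof.
move=> n2 alpha0 Ph q q0 qc cond.
have mq : measurable_fun (`]0%R, +oo[%classic : set R) (EFin \o q).
  apply/measurable_EFinP; apply: (@measurable_funS _ _ _ _ (`[0%R, +oo[%classic : set R)) => //.
    by move=> x; rewrite /= !in_itv/= !andbT => /ltW.
  exact: subspace_continuous_measurable_fun.
have Q0 x : 0 <= x -> (0 <= (EFin \o q) x)%E by move=> x0; rewrite lee_fin q0.
have Q0' x : 0 < x -> (0 <= (EFin \o q) x)%E by move=> /ltW; exact: Q0.
have p0 x : 0 <= x -> (0 <= prim (EFin \o q) x)%E.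
  by move=> x0; apply: integral_ge0 => y; rewrite /= in_itv/= => /andP[y0 _]; exact: Q0'.
have ple : {in `[0, +oo[ &, {homo prim (EFin \o q) : x y / x <= y >-> (x <= y)%E}}.
  move=> x y _ _ xy; apply: ge0_subset_integral => //.
  - by apply: measurable_funS mq => //; exact: sub_itv_oy.
  - by move=> z; rewrite /= in_itv/= => /andP[y0 _]; exact: Q0'.
  - by move=> z; rewrite /= !in_itv/= => /andP[-> /lt_le_trans->].
have pcond (t : R) : 0 <= t ->
    (\int[mu]_(x in `]0%R, 1%R[) (prim (EFin \o q) (t * x) * ((1 - x) ^+ (n - 1) / x)%:E)
     <= (t `^ alpha)%:E)%E.
  rewrite le_eqVlt => /predU1P[<-|t0].
    rewrite integral0_eq ?lee_fin ?powR_ge0// => x _.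
    by rewrite mul0r /prim set_itvoo0 integral_set0 mul0e.
  rewrite integral_prim_kernel//; last 2 first.
  - exact: measurable_onem_kernel.
  - by move=> x; exact: onem_kernel_ge0.
  have -> : t `^ alpha = t * t `^ (alpha - 1).
    rewrite powRB ?(gt_eqF t0) ?implybT// powRr1 ?(ltW t0)// mulrCA mulfV ?mulr1// gt_eqF//.
  rewrite EFinM lee_wpmul2l ?lee_fin ?(ltW t0)//.
  by have := cond t (ltW t0); rewrite /powRy (gt_eqF t0).
have := Ph (prim (EFin \o q)) p0 ple pcond.
have a20 : 0 < 2 * alpha by rewrite mulr_gt0.
rewrite integral_prim_line// lee_pdivrMl// => /le_trans; apply.
by rewrite -EFinM lee_fin le_eqVlt; apply/orP; left; apply/eqP; field.
Qed.

(* Writing [J m] for this integral, Tonelli's theorem applied to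
   [x `^ alpha = \int_0^x alpha y^(alpha - 1) dy] gives
   [m.+1 * (J m - J m.+1) = alpha * J m.+1]. *)
Lemma integral_powR_onem (alpha : R) (m : nat) : 0 < alpha ->
  (\int[mu]_(x in `]0%R, 1%R[) (x `^ (alpha - 1) * (1 - x) ^+ m)%:E =
   ((alpha * \prod_(1 <= k < m.+1) (1 + alpha / k%:R))^-1)%:E)%E.
Proof.
move=> alpha0; pose I01 := `]0, 1[%classic : set R.
have mI : measurable I01 by exact: measurable_itv.
pose J k := (\int[mu]_(x in I01) (x `^ (alpha - 1) * (1 - x) ^+ k)%:E)%E.
have mX k : measurable_fun I01 (fun x : R => (1 - x) ^+ k).
  by apply: measurable_funX; exact: measurable_funB.
have mp p : measurable_fun I01 (fun x : R => x `^ p).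
  by apply: measurable_funTS; exact: measurable_powR.
have X0 k (x : R) : I01 x -> 0 <= (1 - x) ^+ k.
  by rewrite /I01/= in_itv/= => /andP[_ x1]; rewrite exprn_ge0// subr_ge0 ltW.
have J0 k : (0 <= J k)%E.
  by apply: integral_ge0 => x x01; rewrite lee_fin mulr_ge0 ?powR_ge0 ?X0.
pose K k := (\int[mu]_(x in I01) (x `^ alpha * (1 - x) ^+ k)%:E)%E.
have K0 k : (0 <= K k)%E.
  by apply: integral_ge0 => x x01; rewrite lee_fin mulr_ge0 ?powR_ge0 ?X0.
(* Split [1 = (1 - x) + x] inside the integrand of [J k]. *)
have JK k : J k = (J k.+1 + K k)%E.
  rewrite /J /K -ge0_integralD//.
  - apply: eq_integral => x; rewrite inE /I01/= in_itv/= => /andP[x0 x1].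
    rewrite -EFinD; congr (_%:E).
    have -> : x `^ alpha = x * x `^ (alpha - 1).
      rewrite powRB ?(gt_eqF x0) ?implybT// powRr1 ?(ltW x0)// mulrCA mulfV ?mulr1// gt_eqF//.
    by rewrite exprS; ring.
  - by move=> x x01; rewrite lee_fin mulr_ge0 ?powR_ge0 ?X0.
  - by apply/measurable_EFinP; exact: measurable_funM (mp _) (mX _).
  - by move=> x x01; rewrite lee_fin mulr_ge0 ?powR_ge0 ?X0.
  - by apply/measurable_EFinP; exact: measurable_funM (mp _) (mX _).
(* Both sides integrate [alpha y^(alpha-1) (k+1) (1-x)^k] over the triangle [y < x]. *)
have KJ k : (k.+1%:R%:E * K k = alpha%:E * J k.+1)%E.
  have mf : measurable_fun I01 (fun x : R => (alpha * x `^ (alpha - 1))%:E).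
    by apply/measurable_EFinP; apply: measurable_funM => //; exact: mp.
  have mk : measurable_fun I01 (fun x : R => (k.+1%:R * (1 - x) ^+ k)%:E).
    by apply/measurable_EFinP; apply: measurable_funM => //; exact: mX.
  have f0 y : I01 y -> (0 <= (alpha * y `^ (alpha - 1))%:E)%E.
    by move=> _; rewrite lee_fin mulr_ge0 ?powR_ge0 ?ltW.
  have k0 x : I01 x -> (0 <= (k.+1%:R * (1 - x) ^+ k)%:E)%E.
    by move=> x01; rewrite lee_fin mulr_ge0// X0.
  have HI x : I01 x -> `]0, x[%classic = I01 `&` [set y | y < x].
    rewrite /I01/= in_itv/= => /andP[x0 x1]; apply/seteqP; split => y/=.
      by rewrite !in_itv/= => /andP[-> yx]; rewrite (lt_trans yx).
    by rewrite !in_itv/= => -[/andP[-> _] ->].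
  have HJ y : I01 y -> `]y, 1[%classic = I01 `&` [set x | y < x].
    rewrite /I01/= in_itv/= => /andP[y0 y1]; apply/seteqP; split => x/=.
      by rewrite !in_itv/= => /andP[yx ->]; rewrite (lt_trans y0).
    by rewrite !in_itv/= => -[/andP[_ ->] ->].
  have := @ge0_tonelli_subgraph R I01 I01 id (fun x => `]0, x[%classic)
    (fun y => `]y, 1[%classic) _ _ mI mI (@measurable_id _ _ setT) mk mf k0 f0 HI HJ.
  have -> : (\int[mu]_(x in I01) ((k.+1%:R * (1 - x) ^+ k)%:E *
      \int[mu]_(y in `]0%R, x[) (alpha * y `^ (alpha - 1))%:E) = k.+1%:R%:E * K k)%E.
    rewrite -ge0_integralZl//.
    - apply: eq_integral => x; rewrite inE /I01/= in_itv/= => /andP[x0 x1].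
      by rewrite integral_powR// -!EFinM; congr (_%:E); ring.
    - by apply/measurable_EFinP; exact: measurable_funM (mp _) (mX _).
    - by move=> x x01; rewrite lee_fin mulr_ge0 ?powR_ge0 ?X0.
  have -> : (\int[mu]_(y in I01) ((alpha * y `^ (alpha - 1))%:E *
      \int[mu]_(x in `]y, 1%R[) (k.+1%:R * (1 - x) ^+ k)%:E) = alpha%:E * J k.+1)%E.
    rewrite -ge0_integralZl//.
    - apply: eq_integral => x; rewrite inE /I01/= in_itv/= => /andP[x0 x1].
      by rewrite integral_onem_expr// -!EFinM; congr (_%:E); ring.
    - by apply/measurable_EFinP; exact: measurable_funM (mp _) (mX _).
    - by move=> x x01; rewrite lee_fin mulr_ge0 ?powR_ge0 ?X0.
    - by rewrite lee_fin ltW.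
  by [].
rewrite -/(J m); elim: m => [|m IH].
  rewrite big_geq// mulr1.
  have E : (alpha%:E * J 0%N = 1%:E)%E.
    have -> : 1%:E = (1 `^ alpha)%:E :> \bar R by rewrite powR1.
    rewrite -integral_powR// -ge0_integralZl//.
    - by apply: eq_integral => x _; rewrite expr0 mulr1 -EFinM.
    - by apply/measurable_EFinP; exact: measurable_funM (mp _) (mX _).
    - by move=> x x01; rewrite lee_fin mulr_ge0 ?powR_ge0 ?X0.
    - by rewrite lee_fin ltW.
  rewrite -[RHS]mule1 -E muleA -EFinM mulVf ?mul1e//; exact: lt0r_neq0.
(* Both parts of [J m] are finite because [J m] is, so the two relations can be solved in [R]:
   [(m + 1 + alpha) * J m.+1 = (m + 1) * J m]. *)
have Jfin : J m.+1 \is a fin_num.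
  rewrite ge0_fin_numE//; apply: (@le_lt_trans _ _ (J m)).
    by rewrite (JK m) leeDl.
  by rewrite IH ltry.
have Kfin : K m \is a fin_num.
  rewrite ge0_fin_numE//; apply: (@le_lt_trans _ _ (J m)).
    by rewrite (JK m) leeDr.
  by rewrite IH ltry.
rewrite big_nat_recr//=; move: (JK m) (KJ m); rewrite IH.
rewrite -(fineK Jfin) -(fineK Kfin) -EFinD -!EFinM.
have P0 : 0 < \prod_(1 <= k < m.+1) (1 + alpha / k%:R).
  by apply: prodr_gt0 => k _; rewrite ltr_pwDl// divr_ge0// ltW.
move: (fine _) (fine _) (\prod_(_ <= _ < _) _) P0 => c b P P0 [bc] [cb].
congr (_%:E).
have m0 : 0 < (m.+1%:R : R) by rewrite ltr0n.
have mb : (m.+1%:R + alpha) * b = m.+1%:R * (alpha * P)^-1.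
  by rewrite bc mulrDr cb mulrDl.
have ma : 0 < m.+1%:R + alpha by rewrite addr_gt0.
apply: (mulfI (lt0r_neq0 ma)); rewrite mb.
move: (m.+1%:R) m0 ma => N N0 ma; field.
by rewrite !gt_eqF//= addrC.
Qed.

Lemma Beta_natr (alpha : R) (n : nat) : (0 < n)%N -> 0 < alpha ->
  Beta alpha n%:R = (alpha * \prod_(1 <= k < n) (1 + alpha / k%:R))^-1.
Proof.
case: n => // m _ alpha0; rewrite /Beta /Rintegral.
rewrite -[RHS]/(fine _%:E) -integral_powR_onem//; congr fine.
apply: eq_integral => x; rewrite inE/= in_itv/= => /andP[_ x1].
by rewrite -natr1 addrK powR_mulrn// subr_ge0 ltW.
Qed.

End implications.

(** * Functions convex with respect to log, and their increments *)

Section log_convex.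
Context {R : realType}.
Variable S : R -> R.
Hypothesis cS : forall x y t : R, 0 <= t <= 1 ->
  S (expR (t * x + (1 - t) * y)) <= t * S (expR x) + (1 - t) * S (expR y).

(** The maximum of a convex function and a constant is convex. *)
Lemma log_convex_trunc (d : R) (x y t : R) : 0 <= t <= 1 ->
  Num.max (S (expR (t * x + (1 - t) * y)) - d) 0 <=
  t * Num.max (S (expR x) - d) 0 + (1 - t) * Num.max (S (expR y) - d) 0.
Proof.
move=> /[dup] t01 /andP[t0 t1]; have t1' : 0 <= 1 - t by rewrite subr_ge0.
have le_r (z : R) : z <= Num.max z 0 by rewrite le_max lexx.
have le_0 (z : R) : 0 <= Num.max z 0 by rewrite le_max lexx orbT.
rewrite ge_max addr_ge0 ?mulr_ge0// andbT.
have := lerD (ler_wpM2l t0 (le_r (S (expR x) - d))) (ler_wpM2l t1' (le_r (S (expR y) - d))).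
apply: le_trans; have := cS x y t01.
by move: (S _) (S _) (S _) => a b c; lra.
Qed.

(** Increments of a convex function over steps of fixed length [e = - ln r] are nondecreasing. Both
    [ln u] and [ln v - e] are combinations of [ln u - e] and [ln v], with exchanged weights, so
    adding the two convexity inequalities gives the claim. *)
Lemma log_convex_increment (r u v : R) : 0 < r < 1 -> 0 < u -> u <= v ->
  S u - S (r * u) <= S v - S (r * v).
Proof.
move=> /andP[r0 r1] u0 uv; have v0 := lt_le_trans u0 uv.
pose e := - ln r; pose d := ln v - ln u.
have e0 : 0 < e by rewrite oppr_gt0 ln_lt0// r0.
have d0 : 0 <= d by rewrite subr_ge0 ler_ln.
have de0 : 0 < d + e by lra.
pose a := ln u - e; pose b := ln v.
have t0 : 0 <= d / (d + e) <= 1.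
  by rewrite divr_ge0 ?(ltW de0)//= ler_pdivrMr// mul1r; lra.
have t0' : 0 <= e / (d + e) <= 1.
  by rewrite divr_ge0 ?(ltW de0) ?(ltW e0)//= ler_pdivrMr// mul1r; lra.
have := lerD (cS a b t0) (cS a b t0').
have -> : d / (d + e) * a + (1 - d / (d + e)) * b = ln u.
  by rewrite /a /b /d; field; rewrite gt_eqF.
have -> : e / (d + e) * a + (1 - e / (d + e)) * b = ln v - e.
  by rewrite /a /b /d; field; rewrite gt_eqF.
have E w : 0 < w -> expR (ln w - e) = r * w.
  by move=> w0; rewrite /e opprK expRD !lnK ?posrE// mulrC.
rewrite /a /b !E// !lnK ?posrE//.
have -> : e / (d + e) = 1 - d / (d + e) by field; rewrite gt_eqF.
by move: (d / _) (S _) (S _) (S _) (S _) => t p q m n; lra.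
Qed.

(** In the variable [ln x], the slope [M] of the chord over [[z, z + 1]] bounds the increments of
    the monotone convex function [W] within distance 1 of [z], on either side. *)
Lemma log_convex_continuous : {in `[0, +oo[ &, {homo S : x y / x <= y}} ->
  forall x, 0 < x -> {for x, continuous S}.
Proof.
move=> hS x x0; pose W y := S (expR y); pose z := ln x.
have hW : {homo W : a b / a <= b}.
  by move=> a b ab; apply: hS; rewrite ?in_itv/= ?andbT ?expR_ge0// ler_expR.
pose M := W (z + 1) - W z.
have M0 : 0 <= M by rewrite subr_ge0 hW// lerDl.
have ub n : 0 <= n <= 1 -> W (z + n) - W z <= n * M.
  move=> n01; have := cS (z + 1) z n01.
  rewrite (_ : n * (z + 1) + (1 - n) * z = z + n); last by ring.
  by rewrite -/(W (z + n)) -/(W (z + 1)) -/(W z) /M; lra.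
(* Left slopes are at most right slopes: [z] is a convex combination of [z - n] and [z + 1], with
   weight [1 / (1 + n)] on the former. *)
have lb n : 0 <= n <= 1 -> W z - W (z - n) <= n * M.
  move=> /andP[n0 n1]; have n1' : 0 < 1 + n by lra.
  have t01 : 0 <= (1 + n)^-1 <= 1.
    by rewrite invr_ge0 (ltW n1')/= invf_le1//; lra.
  have := cS (z - n) (z + 1) t01.
  have -> : (1 + n)^-1 * (z - n) + (1 - (1 + n)^-1) * (z + 1) = z.
    by field; rewrite gt_eqF.
  rewrite -/(W z) -/(W (z - n)) -/(W (z + 1)) => H.
  have := ler_wpM2l (ltW n1') H.
  rewrite mulrDr !mulrA mulfV ?gt_eqF// mulrBr mulfV ?gt_eqF// mulr1 mul1r /M.
  by move: (W z) (W (z + 1)) (W (z - n)) => p q s; lra.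
have cW : {for z, continuous W}.
  have nd (n : R) : 0 < n -> \forall y \near z, `|z - y| <= n.
    by move=> n0; apply/nbhs_ballP; exists n => // y /ltW.
  apply/cvgrPdist_le => e e0; near=> y.
  have yz1 : `|z - y| <= 1.
    by near: y; exact: nd.
  have yze : `|z - y| * M <= e.
    (* [M] may be 0, so the division is by [M + 1]. *)
    rewrite (@le_trans _ _ (`|z - y| * (M + 1)))//; first by rewrite ler_wpM2l// lerDl.
    rewrite -ler_pdivlMr ?ltr_wpDl//.
    by near: y; apply: nd; rewrite divr_gt0// ltr_wpDl.
  apply: le_trans yze.
  have [zy|yz] := leP z y.
    rewrite distrC (distrC z y) !ger0_norm ?subr_ge0// ?hW//.
    have -> : W y = W (z + (y - z)) by rewrite addrC subrK.
    by apply: ub; rewrite subr_ge0 zy/=; move: yz1; rewrite distrC ger0_norm ?subr_ge0.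
  rewrite !ger0_norm ?subr_ge0 ?(ltW yz)// ?hW// ?(ltW yz)//.
  have -> : W y = W (z - (z - y)) by rewrite subKr.
  by apply: lb; rewrite subr_ge0 (ltW yz)/=; move: yz1; rewrite ger0_norm ?subr_ge0// ltW.
have cc : {for x, continuous (W \o @ln R)}.
  by apply: continuous_comp; [exact: continuous_ln|exact: cW].
rewrite /prop_for /continuous_at; have -> : S x = (W \o @ln R) x by rewrite /W/= lnK.
apply: cvg_trans cc; apply: near_eq_cvg; near=> y.
by rewrite /W/= lnK// posrE; near: y; exact: lt_nbhsr.
Unshelve. all: by end_near. Qed.

End log_convex.

Section log_increment.
Context {R : realType}.
Variables (r t0 : R).
Hypotheses (r01 : 0 < r < 1) (t0_gt0 : 0 < t0).

(** The denominator is the step [ln v - ln (r * v)], so this is a difference quotient in [ln v]. *)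
Definition log_incr (f : R -> R) (v : R) : R := (f v - f (r * v)) / - ln r.

Let scale_le v : v <= t0 -> r * v <= t0.
Proof.
move: r01 => /andP[r0 r1] vt; have [v0|/ltW v0] := leP 0 v.
  by apply: le_trans vt; rewrite ler_piMl ?(ltW r1).
by apply: le_trans (ltW t0_gt0); rewrite mulr_ge0_le0// ltW.
Qed.

Variable f : R -> R.
Hypothesis fz : forall x, x <= t0 -> f x = 0.

Lemma log_incr_eq0 v : v <= t0 -> log_incr f v = 0.
Proof. by move=> vt; rewrite /log_incr !fz ?scale_le// subrr mul0r. Qed.

Lemma log_incr_ge0 v : {homo f : x y / x <= y} -> 0 <= log_incr f v.
Proof.
move=> hf; move: r01 => /andP[r0 r1].
have [vt|/ltW tv] := leP v t0; first by rewrite log_incr_eq0.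
rewrite divr_ge0// ?oppr_ge0 ?ln_le0 ?(ltW r1)// subr_ge0 hf// ger_pMl ?(ltW r1)//.
exact: lt_le_trans tv.
Qed.

Lemma continuous_log_incr : continuous f -> continuous (log_incr f).
Proof.
move=> cf x; apply: cvgM; last exact: cvg_cst.
apply: cvgB; first exact: cf.
apply: (@continuous_comp _ _ _ ( *%R r) f); last exact: cf.
exact: mulrl_continuous.
Qed.

(** The function [f] vanishes at every point up to [t0], negative ones included. This removes the
    singularity at 0 and gives continuity on the whole line. *)
Lemma continuous_div_id : continuous f -> continuous (fun x : R => x^-1 * f x).
Proof.
move=> cf x; have [xt|tx] := ltP x t0.
  rewrite /continuous_at; have -> : x^-1 * f x = 0 by rewrite fz ?mulr0// ltW.
  apply: cvg_near_cst; near=> y.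
  by rewrite fz ?mulr0//; apply: ltW; near: y; exact: lt_nbhsl.
apply: cvgM; last exact: cf.
by apply: inv_continuous; rewrite gt_eqF// (lt_le_trans t0_gt0).
Unshelve. all: by end_near. Qed.

End log_increment.

(** * From the third assertion back to the first *)

Section q_S.
Context {R : realType}.
Notation mu := (@lebesgue_measure R).
Local Notation I01 := (`]0%R, 1%R[%classic : set R).
Local Notation Rpos := (`]0%R, +oo[%classic : set R).

Lemma measurable_itv_nondecreasing (S : R -> R) (t : R) : 0 <= t ->
  {in `[0, +oo[ &, {homo S : x y / x <= y}} -> measurable_fun Rpos (fun x => S (t * x)).
Proof.
move=> t0 hS; apply/measurable_EFinP; apply: nondecreasing_emeasurable => x y.
rewrite !in_itv/= !andbT => x0 y0 xy; rewrite lee_fin hS ?in_itv/= ?andbT ?mulr_ge0//.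
by rewrite ler_wpM2l.
Qed.

Lemma prim_mulV (f : R -> R) (t : R) :
  prim (fun v => (v^-1 * f v)%:E) t = log_prim (EFin \o f) t.
Proof. by apply: eq_integral => x _; rewrite EFinM. Qed.

Variables (m : nat) (alpha lambda : R).
Hypotheses (alpha0 : 0 < alpha) (lE : lambda = 2 * alpha).

Variable S : R -> R.
Hypothesis S0 : forall x, 0 <= x -> 0 <= S x.
Hypothesis hS : {in `[0, +oo[ &, {homo S : x y / x <= y}}.
Hypothesis cS : convex_wrt_log 0%E +oo%E S.
Hypothesis Scond : forall t : R, 0 <= t ->
  (\int[mu]_(x in `]0%R, 1%R[) (S (t * x) * (1 - x ^+ 2) ^+ m * x)%:E
   <= (t `^ lambda)%:E)%E.

Let l0 : 0 < lambda. Proof. by rewrite lE mulr_gt0. Qed.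

(** By monotonicity, [S (t / 2)] times the mass [C] of the disk weight on []1/2, 1[] is at most
    [t^lambda]; the choice of [t] makes this power equal to [d * C]. *)
Lemma S_small (d : R) : 0 < d -> exists2 s0, 0 < s0 & S s0 <= d.
Proof.
move=> d0; pose C : R := (1 - 2^-1 ^+ 2) ^+ m.+1 / (2 * m.+1%:R).
have h1 : (2^-1 : R) < 1 by rewrite invf_lt1// ltr1n.
have C0 : 0 < C.
  apply: divr_gt0; last exact: mulr_gt0.
  by rewrite exprn_gt0// subr_gt0 expr_lt1.
pose t := (d * C) `^ lambda^-1.
have t0 : 0 < t by apply: powR_gt0; exact: mulr_gt0.
exists (t / 2); first by rewrite divr_gt0.
have S20 : 0 <= S (t / 2) by rewrite S0// divr_ge0// ltW.
have mw := @measurable_disk_weight R m.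
have sub : `]2^-1, 1[%classic `<=` I01.
  by move=> x; rewrite /= !in_itv/= => /andP[hx ->]; rewrite (lt_trans _ hx).
have w0 := @disk_weight_ge0 R m.
suff : ((S (t / 2) * C)%:E <= (t `^ lambda)%:E)%E.
  rewrite lee_fin -powRrM mulVf ?gt_eqF// powRr1; last by rewrite mulr_ge0 ?ltW.
  by rewrite ler_pM2r.
apply: le_trans (Scond (ltW t0)).
have mS : measurable_fun I01 (fun x => (S (t * x) * (1 - x ^+ 2) ^+ m * x)%:E).
  apply/measurable_EFinP; apply: measurable_funM => //; apply: measurable_funM.
    apply: measurable_funS (measurable_itv_nondecreasing (ltW t0) hS) => //.
    exact: sub_itv_oy.
  by apply: measurable_funX; apply: measurable_funB => //; exact: measurable_funX.
apply: (@le_trans _ _ (\int[mu]_(x in `](2^-1)%R, 1%R[)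
    (S (t * x) * (1 - x ^+ 2) ^+ m * x)%:E)%E); last first.
  apply: ge0_subset_integral => // x x01; rewrite lee_fin -mulrA mulr_ge0 ?w0//.
  by move: x01; rewrite /= in_itv/= => /andP[x0 _]; rewrite S0// mulr_ge0// ltW.
rewrite EFinM -integral_onem_sqr_expr; last by rewrite h1 invr_ge0 ler0n.
rewrite -ge0_integralZl//.
- apply: ge0_le_integral => //.
  + by move=> x /sub x01; rewrite -EFinM lee_fin mulr_ge0// w0.
  + apply: emeasurable_funM => //; apply/measurable_EFinP.
    exact: measurable_funS mw.
  + exact: measurable_funS mS.
  + move=> x /[dup] /sub x01; rewrite /= in_itv/= => /andP[hx _].
    rewrite -EFinM lee_fin -mulrA ler_wpM2r ?w0// hS ?in_itv/= ?andbT ?divr_ge0 ?(ltW t0)//.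
      by rewrite mulr_ge0 ?(ltW t0)// ltW// (lt_trans _ hx).
    by rewrite ler_wpM2l ?(ltW t0)// ltW.
- by apply/measurable_EFinP; exact: measurable_funS mw.
- by move=> x /sub x01; rewrite lee_fin w0.
Qed.

Hypothesis Pq : assertion_q m.+2 alpha.

Let T d s := Num.max (S s - d) 0.

(* [sg] is [T d] in the variable [v = s ^+ 2], divided by [c]; the function [h]
   is an increment of [sg] and [q v] is [v^-1] times an increment of [h].
   Truncating at height [d] makes [q] vanish near 0, hence continuous there. *)
Lemma assertion_S_trunc_scale (d r : R) : 0 < d -> 0 < r < 1 ->
  (\int[mu]_(t in `]0%R, +oo[)
     (T d (r * t) * (t `^ (2 * lambda - 1) / (1 + t `^ (2 * lambda)) ^+ 2))%:E
   <= (pi * (m.+2 - 1)%:R / (2 * lambda) *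
       \prod_(1 <= k < m.+2) (1 + lambda / (2 * k%:R)))%:E)%E.
Proof.
move=> d0 r01; have /andP[r0 r1] := r01.
have [s0 s0_gt0 Ss0] := S_small d0.
pose c : R := 2 * m.+1%:R.
have c0 : 0 < c by rewrite mulr_gt0.
have ci0 : 0 <= c^-1 by rewrite invr_ge0 ltW.
have T0 s : 0 <= T d s by rewrite le_max lexx orbT.
have Tz s : 0 <= s -> s <= s0 -> T d s = 0.
  move=> s_ge0 ss0; apply/max_idPr; rewrite subr_le0 (le_trans _ Ss0)//.
  by apply: hS; rewrite ?in_itv/= ?andbT// ltW.
have hT : {in `[0, +oo[ &, {homo T d : x y / x <= y}}.
  move=> x y x0 y0 xy; rewrite /T ge_max !le_max lexx orbT andbT.
  by rewrite lerD2r hS.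
have cT := log_convex_trunc (convex_wrt_logE cS) d.
have ctsT := log_convex_continuous cT hT.
have TS s : 0 <= s -> T d s <= S s.
  by move=> s_ge0; rewrite /T ge_max S0// andbT gerBl ltW.
pose t0 := s0 ^+ 2.
have t0_gt0 : 0 < t0 by rewrite exprn_gt0.
pose sg v := c^-1 * T d (Num.sqrt v).
have sgz v : v <= t0 -> sg v = 0.
  move=> vt; rewrite /sg Tz ?mulr0 ?sqrtr_ge0//.
  by rewrite -(gtr0_norm s0_gt0) -sqrtr_sqr ler_sqrt// ltW.
have hsg : {homo sg : x y / x <= y}.
  move=> x y xy; rewrite ler_wpM2l// hT ?in_itv/= ?andbT ?sqrtr_ge0//.
  exact: ler_wsqrtr.
have csg : continuous sg.
  move=> x; have [xt|tx] := ltP x t0.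
    rewrite /continuous_at sgz ?(ltW xt)//; apply: cvg_near_cst; near=> y.
    by apply: sgz; apply: ltW; near: y; exact: lt_nbhsl.
  apply: cvgM; first exact: cvg_cst.
  apply: (@continuous_comp _ _ _ (@Num.sqrt R) (T d)); first exact: sqrt_continuous.
  by apply: ctsT; rewrite sqrtr_gt0 (lt_le_trans t0_gt0).
pose h := log_incr r sg.
have hz v : v <= t0 -> h v = 0 by exact: log_incr_eq0.
have h0 v : 0 <= h v by exact: (log_incr_ge0 r01 t0_gt0 sgz).
have eps0 : 0 < - ln r by rewrite oppr_gt0 ln_lt0// r0.
have hh : {homo h : x y / x <= y}.
  move=> x y xy; have [xt|tx] := leP x t0; first by rewrite hz.
  have x0 : 0 < x by exact: lt_trans tx.
  rewrite ler_wpM2r ?invr_ge0 ?(ltW eps0)// -!mulrBr ler_wpM2l//.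
  rewrite !sqrtrM ?(ltW r0)//.
  (* The ratio [r] in [v = s ^+ 2] is the ratio [sqrt r] in [s], where the convexity of [T d] is
     known. *)
  apply: (log_convex_increment cT).
  - by rewrite sqrtr_gt0 r0 -[ltRHS]sqrtr1 ltr_sqrt.
  - by rewrite sqrtr_gt0.
  - exact: ler_wsqrtr.
have ch : continuous h by exact: continuous_log_incr.
pose q v := v^-1 * log_incr r h v.
have q0 v : 0 <= v -> 0 <= q v.
  by move=> v0; rewrite mulr_ge0 ?invr_ge0// (log_incr_ge0 r01 t0_gt0 hz).
have cq : continuous q.
  apply: (continuous_div_id t0_gt0); first exact: log_incr_eq0.
  exact: continuous_log_incr.
have mq : measurable_fun Rpos (EFin \o q).
  apply/measurable_EFinP; apply: continuous_measurable_itv => x _; exact: cq.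
have mh : measurable_fun setT h by exact: nondecreasing_measurable.
(* In [hq] and [hs] the upper bounds carry the hypothesis from [S] down to [q], and the lower bounds
   carry the conclusion back. Each lower bound costs a dilation by [r] in [v]; together this is
   [r ^+ 2] in [v], hence [r] in [s]. *)
have hq (t : R) : 0 < t -> ((h (r * t))%:E <= prim (EFin \o q) t <= (h t)%:E)%E.
  move=> tp; rewrite prim_mulV.
  exact: (log_prim_increment r01 t0_gt0 tp hh hz).
have hs (t : R) : 0 < t -> ((sg (r * t))%:E <= log_prim (EFin \o h) t <= (sg t)%:E)%E.
  by move=> tp; exact: (log_prim_increment r01 t0_gt0 tp hsg sgz).
have Q0 x : 0 < x -> (0 <= (EFin \o q) x)%E by move=> x0; rewrite lee_fin q0// ltW.
have H0 x : 0 < x -> (0 <= (EFin \o h) x)%E by move=> _; rewrite lee_fin.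
have mH : measurable_fun Rpos (EFin \o h).
  by apply/measurable_EFinP; exact: measurable_funTS.
have mprim : measurable_fun Rpos (prim (EFin \o q)).
  apply: nondecreasing_emeasurable => x y _ _ xy; apply: ge0_subset_integral => //.
  - by apply: measurable_funS mq => //; exact: sub_itv_oy.
  - by move=> z; rewrite /= in_itv/= => /andP[z0 _]; exact: Q0.
  - by move=> z; rewrite /= !in_itv/= => /andP[-> /lt_le_trans->].
have prim0 x : (0 <= prim (EFin \o q) x)%E.
  by apply: integral_ge0 => z; rewrite /= in_itv/= => /andP[z0 _]; exact: Q0.
have qcond (t : R) : 0 <= t ->
   (\int[mu]_(x in `]0%R, 1%R[)
      ((\int[mu]_(y in `]x, 1%R[) ((1 - y) ^+ (m.+2 - 1) / y)%:E) * (q (t * x)%R)%:E)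
    <= powRy t (alpha - 1))%E.
  rewrite le_eqVlt => /predU1P[<-|tp].
    rewrite integral0_eq; first by rewrite /powRy; case: ifP => // _; rewrite lee_fin powR_ge0.
    (* At [t = 0] the convention [0^-1 = 0] gives [q 0 = 0], and the right-hand side is nonnegative
       for every [alpha]. *)
    by move=> x _; rewrite mul0r /q invr0 mul0r mule0.
  rewrite /powRy (gt_eqF tp)/= subn1/=.
  have -> : t `^ (alpha - 1) = t^-1 * t `^ alpha.
    by rewrite powRB ?(gt_eqF tp) ?implybT// powRr1 ?(ltW tp)// mulrC.
  rewrite EFinM lee_pdivlMl//.
  rewrite -(@integral_prim_kernel _ (EFin \o q))//; last 2 first.
  - exact: measurable_onem_kernel.
  - by move=> x; exact: onem_kernel_ge0.
  have mk := @measurable_onem_kernel R m.+1.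
  apply: (@le_trans _ _ (\int[mu]_(x in `]0%R, 1%R[)
      ((h (t * x))%:E * ((1 - x) ^+ m.+1 / x)%:E))%E).
    apply: ge0_le_integral => //.
    + by move=> x x01; rewrite mule_ge0 ?prim0 ?onem_kernel_ge0.
    + apply: emeasurable_funM => //.
      by apply: measurable_funS (measurable_fun_scale tp mprim) => //; exact: sub_itv_oy.
    + apply: emeasurable_funM => //.
      by apply: measurable_funS (measurable_fun_scale tp mH) => //; exact: sub_itv_oy.
    + move=> x /[dup] x01; rewrite /= in_itv/= => /andP[x0 x1].
      rewrite lee_wpmul2r ?onem_kernel_ge0//.
      by have /andP[] := hq (t * x) (mulr_gt0 tp x0).
  (* The condition on [S] is applied at [s], where [s^lambda = t^alpha]. *)
  pose s := Num.sqrt t.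
  have sp : 0 < s by rewrite sqrtr_gt0.
  have s2 : s ^+ 2 = t by rewrite sqr_sqrtr// ltW.
  have := integral_log_prim_disk m sp mH H0.
  rewrite s2 -/c => disk.
  (* Inserting [c * c^-1] exposes the right-hand side of [disk], where [c^-1] is the constant of the
     disk integral. *)
  have cV : (1 = c%:E * (c^-1)%:E :> \bar R)%E by rewrite -EFinM mulfV// gt_eqF.
  rewrite -[leLHS]mul1e cV -muleA -[X in (_ * X <= _)%E]disk.
  have -> : t `^ alpha = c * (c^-1 * s `^ lambda).
    by rewrite mulrA mulfV ?gt_eqF// mul1r lE powRrM (powR_mulrn 2 (ltW sp)) s2.
  rewrite [leRHS]EFinM lee_wpmul2l ?lee_fin ?(ltW c0)//.
  have mS : measurable_fun I01 (fun x => (S (s * x) * (1 - x ^+ 2) ^+ m * x)%:E).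
    apply/measurable_EFinP; apply: measurable_funM => //; apply: measurable_funM.
      apply: measurable_funS (measurable_itv_nondecreasing (ltW sp) hS) => //.
      exact: sub_itv_oy.
    by apply: measurable_funX; apply: measurable_funB => //; exact: measurable_funX.
  have w0 := @disk_weight_ge0 R m.
  have S00 x : I01 x -> (0 <= (S (s * x) * (1 - x ^+ 2) ^+ m * x)%:E)%E.
    move=> x01; rewrite lee_fin -mulrA mulr_ge0 ?w0//.
    by move: x01; rewrite /= in_itv/= => /andP[x0 _]; rewrite S0// mulr_ge0// ltW.
  rewrite EFinM; apply: le_trans (lee_wpmul2l _ (Scond (ltW sp))); last by rewrite lee_fin.
  rewrite -ge0_integralZl//.
  apply: ge0_le_integral => //.
  - move=> x x01; rewrite mule_ge0 ?lee_fin ?w0//; apply: log_prim_ge0 => y y0.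
    by rewrite lee_fin.
  - apply: emeasurable_funM; last first.
      apply: measurable_log_prim_sqr => //; [exact: ltW|exact: sub_itv_oy| |].
      + by move=> x y _ _ xy; rewrite lee_fin hh.
      + by move=> y y0; rewrite lee_fin.
    by apply/measurable_EFinP; exact: measurable_disk_weight.
  - exact: emeasurable_funM.
  - move=> x /[dup] x01; rewrite /= in_itv/= => /andP[x0 x1].
    have sx : 0 < s * x by exact: mulr_gt0.
    have /andP[_ ub] := hs ((s * x) ^+ 2) (exprn_gt0 2 sx).
    apply: le_trans (lee_wpmul2l _ ub) _; first by rewrite lee_fin w0.
    rewrite /sg sqrtr_sqr gtr0_norm// -!EFinM lee_fin mulrCA ler_wpM2l//.
    by rewrite -mulrA [leRHS]mulrC ler_wpM2l ?w0// TS// ltW.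
have qconcl := Pq q0 (continuous_subspaceT cq) qcond.
have l20 : 0 < 2 * lambda by rewrite mulr_gt0.
have wl := @log_weight_ge0 R lambda.
have mwl := @measurable_log_weight R lambda.
have hconcl : (\int[mu]_(x in `]0%R, +oo[) ((h (r * x))%:E * (x^-1 * (1 + x `^ lambda)^-1)%:E)
    <= (lambda^-1 * (pi * alpha * \prod_(1 <= k < m.+2) (1 + alpha / k%:R)))%:E)%E.
  rewrite EFinM; apply: le_trans (lee_wpmul2l _ qconcl); last by rewrite lee_fin invr_ge0 ltW.
  rewrite -lE -(@integral_prim_line _ (EFin \o q))//.
  apply: ge0_le_integral => //.
  - by move=> x; rewrite /= in_itv/= andbT => x0; rewrite mule_ge0 ?wl// lee_fin.
  - by apply: emeasurable_funM => //; exact: (measurable_fun_scale r0 mH).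
  - exact: emeasurable_funM.
  - move=> x; rewrite /= in_itv/= andbT => x0; rewrite lee_wpmul2r ?wl//.
    by have /andP[] := hq x x0.
have mHr := measurable_fun_scale r0 mH.
have Hr0 (x : R) : 0 < x -> (0 <= (EFin \o h) (r * x)%R)%E by move=> _; rewrite lee_fin.
have line := integral_log_prim_line l0 mHr Hr0.
have mT : measurable_fun Rpos (fun t => T d (r * t)).
  exact: measurable_itv_nondecreasing (ltW r0) hT.
have w0 (t : R) : 0 <= t `^ (2 * lambda - 1) / (1 + t `^ (2 * lambda)) ^+ 2.
  by rewrite divr_ge0 ?powR_ge0 ?sqr_ge0.
(* The bound [hconcl] concerns the dilated [h], so [line] is used for that function. Dilation
   invariance moves [r] into the endpoint [r * x ^+ 2], where the lower bound of [hs] reads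
   [c^-1 * T d (r * x)]. *)
apply: (@le_trans _ _ (c%:E * \int[mu]_(x in `]0%R, +oo[)
    ((x `^ (2 * lambda - 1) / (1 + x `^ (2 * lambda)) ^+ 2)%:E *
      log_prim (fun x0 : R => (EFin \o h) (r * x0)%R) (x ^+ 2)%R))%E).
  rewrite -lee_pdivrMl// -ge0_integralZl//.
  - apply: ge0_le_integral => //.
    + by move=> x _; rewrite mule_ge0// lee_fin ?invr_ge0 ?(ltW c0)// mulr_ge0.
    + apply: emeasurable_funM => //; apply/measurable_EFinP.
      by apply: measurable_funM => //; exact: measurable_line_weight.
    + apply: emeasurable_funM.
        by apply/measurable_EFinP; exact: measurable_line_weight.
      apply: (@eq_measurable_fun _ _ _ _ _ (fun x : R =>
          log_prim (fun y => (EFin \o h) (r * y)) ((1 * x) ^+ 2))).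
        by move=> x _; rewrite mul1r.
      apply: measurable_log_prim_sqr => // [x y _ _ xy|y _]; rewrite lee_fin// hh//.
      by rewrite ler_wpM2l// ltW.
    + move=> x; rewrite /= in_itv/= andbT => x0.
      rewrite (log_prim_scale _ r0 mH H0).
      have x20 : 0 < r * x ^+ 2 by rewrite mulr_gt0// exprn_gt0.
      have /andP[lb _] := hs _ x20.
      apply: le_trans (lee_wpmul2l _ lb); last by rewrite lee_fin.
      rewrite /sg mulrA -expr2 -exprMn sqrtr_sqr gtr0_norm ?mulr_gt0//.
      by rewrite -!EFinM lee_fin mulrA mulrC.
  - by apply/measurable_EFinP; apply: measurable_funM => //; exact: measurable_line_weight.
  - by move=> x _; rewrite lee_fin mulr_ge0.
rewrite line muleA -EFinM.
apply: le_trans (lee_wpmul2l _ hconcl) _.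
  by rewrite lee_fin mulr_ge0 ?(ltW c0)// invr_ge0 ltW.
rewrite -EFinM lee_fin le_eqVlt; apply/orP; left; apply/eqP.
rewrite subn1/=.
rewrite [in RHS](eq_big_nat _ _ (F2 := fun k => 1 + alpha / k%:R)); last first.
  by move=> k _; rewrite lE invfM mulrACA mulfV ?mul1r.
rewrite /c lE; move: (\prod_(_ <= _ < _) _) => P; field.
by rewrite gt_eqF.
Unshelve. all: by end_near. Qed.

(** Monotone convergence with [d = e k] and [r = 1 - e k]. As [e k] decreases to 0 both the
    truncation and the dilation increase the integrand, and continuity of [S] on []0, +oo[]
    identifies the limit. The sequence starts at [1/2], so [r] lies strictly between 0 and 1. *)
Lemma assertion_S_concl :
  (\int[mu]_(t in `]0%R, +oo[)
     (S t * (t `^ (2 * lambda - 1) / (1 + t `^ (2 * lambda)) ^+ 2))%:E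
   <= (pi * (m.+2 - 1)%:R / (2 * lambda) *
       \prod_(1 <= k < m.+2) (1 + lambda / (2 * k%:R)))%:E)%E.
Proof.
pose w (t : R) := t `^ (2 * lambda - 1) / (1 + t `^ (2 * lambda)) ^+ 2.
have w0 (t : R) : 0 <= w t by rewrite divr_ge0 ?powR_ge0 ?sqr_ge0.
pose e (k : nat) : R := k.+2%:R^-1.
have e0 k : 0 < e k by rewrite invr_gt0.
have e1 k : e k < 1 by rewrite invf_lt1// ltr1n.
have e_ni : {homo e : i j / (i <= j)%N >-> j <= i}.
  by move=> i j ij; rewrite lef_pV2 ?posrE// ler_nat.
have e_cvg : e k @[k --> \oo] --> 0.
  by have := @cvg_harmonic R; rewrite -(cvg_shiftS (@harmonic R)).
have r01 k : 0 < 1 - e k < 1 by rewrite subr_gt0 e1 gtrBl e0.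
pose f k t := (T (e k) ((1 - e k) * t) * w t)%:E.
have hT d : {in `[0, +oo[ &, {homo T d : x y / x <= y}}.
  move=> x y x0 y0 xy; rewrite /T ge_max !le_max lexx orbT andbT.
  by rewrite lerD2r hS.
have mf k : measurable_fun Rpos (f k).
  apply/measurable_EFinP; apply: measurable_funM; last exact: measurable_line_weight.
  by apply: measurable_itv_nondecreasing => //; have /andP[/ltW] := r01 k.
have f0 k t : Rpos t -> (0 <= f k t)%E.
  by move=> _; rewrite lee_fin mulr_ge0// le_max lexx orbT.
have fnd t : Rpos t -> {homo f^~ t : i j / (i <= j)%N >-> (i <= j)%E}.
  rewrite /= in_itv/= andbT => t0 i j ij; rewrite lee_fin ler_wpM2r//.
  rewrite /T ge_max !le_max lexx orbT andbT lerD ?lerN2 ?e_ni//.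
  have := r01 i; have := r01 j => /andP[rj _] /andP[ri _].
  rewrite hS ?in_itv/= ?andbT ?mulr_ge0 ?(ltW ri) ?(ltW rj) ?(ltW t0)//.
  by rewrite ler_wpM2r ?(ltW t0)// lerD2l lerN2 e_ni.
have fcvg t : Rpos t -> f k t @[k --> \oo] --> (S t * w t)%:E.
  rewrite /= in_itv/= andbT => t0; apply: cvg_EFin; first by near=> k.
  apply: cvgM; last exact: cvg_cst.
  have L : S ((1 - e k) * t) - e k @[k --> \oo] --> S t - 0.
    apply: (cvgB _ e_cvg).
    have L : (1 - e k) * t @[k --> \oo] --> t.
      rewrite -[X in _ --> X]mul1r; apply: cvgM; last exact: cvg_cst.
      by rewrite -[X in _ --> X]subr0; apply: (cvgB _ e_cvg); exact: cvg_cst.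
    apply: (@cvg_comp _ _ _ (fun k => (1 - e k) * t) S _ _ _ L).
    exact: (log_convex_continuous (convex_wrt_logE cS) hS).
  have -> : S t = Num.max (S t - 0) 0.
    by rewrite subr0; apply/esym/max_idPl; rewrite S0// ltW.
  apply: (@cvg_comp _ _ _ _ (fun z : R => Num.max z 0) _ _ _ L).
  by apply: (@continuous_max _ _ (fun z : R => z) (fun=> 0)); [exact: cvg_id|exact: cvg_cst].
have := cvg_monotone_convergence (mu := mu) (measurable_itv `]0%R, +oo[) mf f0 fnd.
move=> C.
have -> : (\int[mu]_(t in `]0%R, +oo[) (S t * w t)%:E =
    \int[mu]_(t in `]0%R, +oo[) limn (f^~ t))%E.
  by apply: eq_integral => t /set_mem t0; apply/esym/cvg_lim => //; exact: fcvg.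
rewrite -(cvg_lim _ C)//; apply: lime_le; first by apply/cvg_ex; eexists; exact: C.
by near=> k; apply: assertion_S_trunc_scale.
Unshelve. all: by end_near. Qed.

End q_S.

Lemma assertion_q_S (R : realType) (n : nat) (alpha lambda : R) : (2 <= n)%N -> 0 < alpha ->
  lambda = 2 * alpha -> assertion_q n alpha -> assertion_S n lambda.
Proof.
case: n => [|[|m]]// _ a0 lE Pq S S0 hS cS; rewrite subn2/= => Scond.
exact: (assertion_S_concl a0 lE S0 hS cS Scond Pq).
Qed.

Theorem mainTheorem2 (R : realType) (n : nat) (alpha lambda : R)
    (hn : (2 <= n)%N) (halpha : 1 / 2 < alpha) (hlambda : lambda = 2 * alpha) :
  [<->
    forall S : R -> R,
      (forall x, 0 <= x -> 0 <= S x) ->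
      {in `[0, +oo[ &, {homo S : x y / x <= y}} ->
      convex_wrt_log 0%E +oo%E S ->
      (forall t : R, 0 <= t ->
        (\int[lebesgue_measure]_(x in `]0%R, 1%R[)
           (S (t * x) * (1 - x ^+ 2) ^+ (n - 2) * x)%:E
         <= (t `^ lambda)%:E)%E) ->
      (\int[lebesgue_measure]_(t in `]0%R, +oo[)
         (S t * (t `^ (2 * lambda - 1) / (1 + t `^ (2 * lambda)) ^+ 2))%:E
       <= (pi * (n - 1)%:R / (2 * lambda) *
           \prod_(1 <= k < n) (1 + lambda / (2 * k%:R)))%:E)%E;

    forall h : R -> \bar R,
      (forall x, 0 <= x -> (0 <= h x)%E) ->
      {in `[0, +oo[ &, {homo h : x y / x <= y >-> (x <= y)%E}} ->
      (forall t : R, 0 <= t ->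
        (\int[lebesgue_measure]_(x in `]0%R, 1%R[)
           (h (t * x)%R * ((1 - x) ^+ (n - 1) / x)%:E)
         <= (t `^ alpha)%:E)%E) ->
      (\int[lebesgue_measure]_(t in `]0%R, +oo[)
         (h t * (t^-1 * (1 + t `^ (2 * alpha))^-1)%:E)
       <= (pi / 2 * \prod_(1 <= k < n) (1 + alpha / k%:R))%:E)%E;

    forall q : R -> R,
      (forall x, 0 <= x -> 0 <= q x) ->
      {within `[0, +oo[, continuous q} ->
      (forall t : R, 0 <= t ->
        (\int[lebesgue_measure]_(x in `]0%R, 1%R[)
           ((\int[lebesgue_measure]_(y in `]x, 1%R[)
               ((1 - y) ^+ (n - 1) / y)%:E) * (q (t * x)%R)%:E)
         <= powRy t (alpha - 1))%E) ->
      (\int[lebesgue_measure]_(t in `]0%R, +oo[)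
         (q t * ln (1 + 1 / t `^ (2 * alpha)))%:E
       <= (pi * alpha * \prod_(1 <= k < n) (1 + alpha / k%:R))%:E)%E ]
  /\ pi / 2 * \prod_(1 <= k < n) (1 + alpha / k%:R)
       = pi / (2 * alpha) * (1 / Beta alpha n%:R)
  /\ pi * alpha * \prod_(1 <= k < n) (1 + alpha / k%:R)
       = pi / Beta alpha n%:R.
Proof.
have alpha0 : 0 < alpha by apply: lt_trans halpha; rewrite divr_gt0.
have n0 : (0 < n)%N by exact: ltn_trans hn.
split; first split.
- exact: assertion_S_h hn alpha0 hlambda.
- split; first exact: assertion_h_q hn alpha0.
  exact: assertion_q_S hn alpha0 hlambda.
rewrite Beta_natr//; move: (\prod_(_ <= _ < _) _) => P.
by rewrite div1r !invrK; split; [field; rewrite gt_eqF|ring].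
Qed.
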